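(* Let $m\in\mathbb N_0\cup\{\infty\}$, let $(\tilde\nu_n)_{n=0}^m$ be positive regular Borel measures on $[0,\infty)$ each satisfying the $\Delta_2$-condition, and let $A^2_{(m)}$ be the associated Hilbert space of analytic functions on $\mathbb C_+$. Let $\rho:\mathbb C_+\to(0,\infty)$ be a regular weight such that $$\|F\|^2_{A^2_{(m)}}\ge\int_{\mathbb C_+}|F'(z)|^2\rho(z)\,dz\qquad\text{for all }F\in A^2_{(m)},$$ and let $\mu$ be a positive Borel measure on $\mathbb C_+$. If there is a constant $C(\mu,\rho)>0$ such that for all $a\in\mathbb C_+$ $$\int_{Q(a)}\left(\frac{\mu(Q(a)\cap Q(z))}{\operatorname{Re}(z)}\right)^2\frac{dz}{\rho(z)}\le C(\mu,\rho)\,\mu(Q(a)),$$ then $\mu$ is a Carleson measure for $A^2_{(m)}$.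
   Context: $\mathbb C_+=\{z\in\mathbb C:\operatorname{Re}z>0\}$ and $dz$ denotes area (Lebesgue) measure on $\mathbb C_+$. A positive regular Borel measure $\tilde\nu$ on $[0,\infty)$ satisfies the $\Delta_2$-condition if $\sup_{r>0}\tilde\nu[0,2r)/\tilde\nu[0,r)<\infty$. For $t>0$ put $w_n(t)=2\pi t^{2n}\int_0^\infty e^{-2rt}\,d\tilde\nu_n(r)$ and $w_{(m)}(t)=\sum_{n=0}^m w_n(t)$. $L^2_{w_{(m)}}(0,\infty)$ is the Hilbert space of $f:(0,\infty)\to\mathbb C$ with $\|f\|^2=\int_0^\infty|f(t)|^2w_{(m)}(t)\,dt<\infty$, $\mathfrak L[f](z)=\int_0^\infty f(t)e^{-tz}\,dt$ is the Laplace transform, and $A^2_{(m)}=\mathfrak L(L^2_{w_{(m)}}(0,\infty))$ with norm $\|\mathfrak L[f]\|_{A^2_{(m)}}=\|f\|_{L^2_{w_{(m)}}(0,\infty)}$; it is a reproducing kernel Hilbert space of analytic functions on $\mathbb C_+$ with kernel $k_z(\zeta)=\int_0^\infty e^{-t(\overline z+\zeta)}/w_{(m)}(t)\,dt$. A positive weight $\rho:\mathbb C_+\to(0,\infty)$ is regular if for every $\varepsilon>0$ there is $\delta>0$ such that $\rho(z_1)\le\delta\rho(z_2)$ whenever $d_H(z_1,z_2)\le\varepsilon$, where $$d_H(z_1,z_2)=\cosh^{-1}\left(1+\frac{(\operatorname{Re}z_1-\operatorname{Re}z_2)^2+(\operatorname{Im}z_1-\operatorname{Im}z_2)^2}{2\operatorname{Re}z_1\operatorname{Re}z_2}\right).$$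 For $a\in\mathbb C_+$, $Q(a)=\{x+iy:\ 0<x\le2\operatorname{Re}(a),\ |y-\operatorname{Im}(a)|\le\operatorname{Re}(a)\}$. A positive Borel measure $\mu$ on $\mathbb C_+$ is a Carleson measure for a Hilbert space $\mathcal H$ of functions on $\mathbb C_+$ if there is a constant $C>0$ with $\int_{\mathbb C_+}|h|^2\,d\mu\le C\|h\|^2_{\mathcal H}$ for all $h\in\mathcal H$.
   Formalization: The formal theorem additionally assumes μ(Q(a)) < ∞ for every a in C_+; otherwise the testing condition can hold vacuously (e.g. ν̃_0 = δ_0, ρ = Re z, dμ = dz/(Re z)^2) while μ is not Carleson. *)

(* Defs.v *)
From mathcomp Require Import all_boot all_order all_algebra.
From mathcomp Require Import all_classical all_reals all_analysis.
From mathcomp Require Import complex.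

Set Implicit Arguments.
Unset Strict Implicit.
Unset Printing Implicit Defensive.

Import Order.TTheory GRing.Theory Num.Theory.
Import numFieldNormedType.Exports.

Local Open Scope classical_set_scope.
Local Open Scope ring_scope.

(* Points z = x + iy that are integrated over are pairs (x, y), so that
   Re z = z.1, Im z = z.2, and the Borel sets and the area measure are those of
   the product; analytic functions have type R[i] -> R[i]. *)
Notation plane R := (measurableTypeR R * measurableTypeR R)%type.

Definition toC (R : realType) (z : plane R) : R[i] := Complex z.1 z.2.

Definition Cplus (R : realType) : set (plane R) := [set z | 0 < z.1].

Definition area (R : realType) : {measure set (plane R) -> \bar R} :=
  (@lebesgue_measure R \x @lebesgue_measure R)%E.

(* A Borel measure on a Borel subset X of an ambient space is encoded as its
   extension by zero, i.e. as a measure on the ambient space vanishing off X. *)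
Definition carried_by (d : measure_display) (T : measurableType d)
    (R : realType) (mu : {measure set T -> \bar R}) (X : set T) : Prop :=
  mu (~` X) = 0%E.

Definition regular_borel (R : realType)
    (nu : {measure set (measurableTypeR R) -> \bar R}) : Prop :=
  [/\ forall K : set R, compact K -> (nu K < +oo)%E,
      forall A : set R, measurable A ->
        nu A = ereal_inf [set nu U | U in [set U : set R | open U /\ A `<=` U]]
    & forall A : set R, measurable A ->
        nu A = ereal_sup [set nu K | K in [set K : set R | compact K /\ K `<=` A]]].

(* In \bar R one has 0 / 0 = 0, so the requirement that the quotient be
   meaningful (nonzero denominator) has to be stated separately. *)
Definition doubling (R : realType)
    (nu : {measure set (measurableTypeR R) -> \bar R}) : Prop :=
  (forall r : R, 0 < r -> (0 < nu `[0%R, r[%classic)%E) /\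
  (ereal_sup [set nu `[0%R, (2 * r)%R[%classic / nu `[0%R, r[%classic |
                r in [set r : R | 0 < r]%R] < +oo)%E.

(* n <= m, for m : option nat, where None stands for m = oo. *)
Definition index_le (n : nat) (m : option nat) : bool :=
  if m is Some k then (n <= k)%N else true.

Definition wn (R : realType)
    (nu : nat -> {measure set (measurableTypeR R) -> \bar R}) (n : nat) (t : R) : \bar R :=
  ((2 * pi * t ^+ (2 * n))%:E *
   \int[nu n]_(r in `[0%R, +oo[%classic) (expR (- (2 * r * t)))%:E)%E.

(* For m = oo the sum may be +oo at some t; since 0 * +oo = 0, functions of
   finite norm then vanish a.e. on the set of such t. *)
Definition weight (R : realType) (m : option nat)
    (nu : nat -> {measure set (measurableTypeR R) -> \bar R}) (t : R) : \bar R :=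
  (\sum_(0 <= n <oo | index_le n m) wn nu n t)%E.

Definition cmod (R : realType) (z : R[i]) : R := ComplexField.Normc.normc z.

Definition L2_sqnorm (R : realType) (w : R -> \bar R) (f : R -> R[i]) : \bar R :=
  (\int[@lebesgue_measure R]_(t in `]0%R, +oo[%classic)
     ((cmod (f t) ^+ 2)%:E * w t))%E.

Definition L2 (R : realType) (w : R -> \bar R) : set (R -> R[i]) :=
  [set f | [/\ measurable_fun (`]0, +oo[%classic : set R) (fun t => complex.Re (f t)),
               measurable_fun (`]0, +oo[%classic : set R) (fun t => complex.Im (f t))
             & (L2_sqnorm w f < +oo)%E]].

Definition cexp (R : realType) (z : R[i]) : R[i] :=
  Complex (expR (complex.Re z) * cos (complex.Im z))
          (expR (complex.Re z) * sin (complex.Im z)).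

Definition laplace (R : realType) (f : R -> R[i]) (z : R[i]) : R[i] :=
  let g t := f t * cexp (- (t%:C%C * z)) in
  Complex (\int[@lebesgue_measure R]_(t in `]0%R, +oo[%classic) complex.Re (g t))
          (\int[@lebesgue_measure R]_(t in `]0%R, +oo[%classic) complex.Im (g t)).

(* Complex derivative: derive1 over the field R[i], whose topology as a
   numFieldType is carried by the regular module R[i]^o. *)
Definition cderiv (R : realType) (F : R[i] -> R[i]) (z : R[i]) : R[i] :=
  derive1 (F : R[i]^o -> R[i]^o) z.

(* F, a function on the half-plane, is represented by any extension to R[i]:
   values off the half-plane are irrelevant. *)
Definition is_laplace (R : realType) (F : R[i] -> R[i]) (f : R -> R[i]) : Prop :=
  forall z, Cplus z -> F (toC z) = laplace f (toC z).

Definition A2 (R : realType) (m : option nat)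
    (nu : nat -> {measure set (measurableTypeR R) -> \bar R}) : set (R[i] -> R[i]) :=
  [set F | exists2 f, L2 (weight m nu) f & is_laplace F f].

(* The square of the norm carried over from L2 by the Laplace transform. As the
   transform is injective up to a.e. equality, all f with laplace f = F have
   the same norm, and the infimum is over a one-point set. *)
Definition A2_sqnorm (R : realType) (m : option nat)
    (nu : nat -> {measure set (measurableTypeR R) -> \bar R}) (F : R[i] -> R[i]) : \bar R :=
  ereal_inf [set L2_sqnorm (weight m nu) f |
             f in [set f | L2 (weight m nu) f /\ is_laplace F f]].

(* The inverse of cosh : [0, +oo[ -> [1, +oo[. *)
Definition arcosh (R : realType) (u : R) : R := ln (u + Num.sqrt (u ^+ 2 - 1)).

Lemma arcosh_ge0 (R : realType) (u : R) : 1 <= u -> 0 <= arcosh u.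
Proof.
by move=> u1; rewrite ln_ge0// (le_trans u1)// lerDl sqrtr_ge0.
Qed.

Lemma arcoshK (R : realType) (u : R) : 1 <= u ->
  (expR (arcosh u) + expR (- arcosh u)) / 2 = u.
Proof.
move=> u1; set s := Num.sqrt (u ^+ 2 - 1).
have s2 : s ^+ 2 = u ^+ 2 - 1.
  by rewrite sqr_sqrtr// subr_ge0 exprn_ege1.
have us0 : 0 < u + s.
  by rewrite ltr_pwDl ?sqrtr_ge0// (lt_le_trans ltr01).
rewrite expRN /arcosh -/s lnK ?posrE//.
have -> : (u + s)^-1 = u - s.
  apply: (mulfI (lt0r_neq0 us0)); rewrite divff ?lt0r_neq0//.
  by rewrite mulrC -subr_sqr s2 opprB addrCA subrr addr0.
by rewrite addrACA subrr addr0 -mulr2n -[u *+ 2]mulr_natr mulfK// pnatr_eq0.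
Qed.

Definition dH (R : realType) (z1 z2 : plane R) : R :=
  arcosh (1 + ((z1.1 - z2.1) ^+ 2 + (z1.2 - z2.2) ^+ 2) / (2 * z1.1 * z2.1)).

Definition regular_weight (R : realType) (rho : plane R -> R) : Prop :=
  [/\ measurable_fun (@Cplus R) rho,
      forall z, Cplus z -> 0 < rho z
    & forall e : R, 0 < e -> exists2 delta : R, 0 < delta &
        forall z1 z2, Cplus z1 -> Cplus z2 -> dH z1 z2 <= e ->
          rho z1 <= delta * rho z2].

Definition Qbox (R : realType) (a : plane R) : set (plane R) :=
  [set z | 0 < z.1 <= 2 * a.1 /\ `|z.2 - a.2| <= a.1].

Definition carleson_measure (R : realType)
    (mu : {measure set (plane R) -> \bar R})
    (H : set (R[i] -> R[i])) (sqnorm : (R[i] -> R[i]) -> \bar R) : Prop :=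
  exists2 C : R, 0 < C & forall h, H h ->
    (\int[mu]_(z in @Cplus R) (cmod (h (toC z)) ^+ 2)%:E <= C%:E * sqnorm h)%E.

(* Main.v *)
Require Import Defs.
From HB Require Import structures.
From mathcomp Require Import all_boot all_order all_algebra.
From mathcomp Require Import all_classical all_reals all_analysis.
From mathcomp Require Import measurable_realfun complex ring lra zify.

Set Implicit Arguments.
Unset Strict Implicit.
Unset Printing Implicit Defensive.

Import Order.TTheory GRing.Theory Num.Theory.
Import numFieldNormedType.Exports.

Local Open Scope classical_set_scope.
Local Open Scope ring_scope.

(** The half-plane is cut into dyadic boxes S = {0 < x < 2^k,
    j 2^k <= y < (j + 1) 2^k}. Two boxes are nested or disjoint, so the boxes
    through a point form a chain. The proof bounds |F| by a sum over this
    chain, and then proves a two-weight inequality for such sums.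

    Bounding |F|. Let F be the Laplace transform of f. Since nu_0 charges every
    interval [0, e[, the weight is at least c exp(- 2 e t), so f is integrable
    against exp(- t x) for every x > 0 (L2_admissible). Hence F is holomorphic
    with F' the transform of - t f (transform_cderiv), and F tends to 0 along
    horizontal half-lines, uniformly in y (expabs_decay). A horizontal half-line
    from z runs through the upper halves of the successive boxes that contain z,
    so |F(z)| is at most the sum of the increments of F over these upper halves
    (osclap_chain). An increment is at most 2^k sup |F'|, and the area mean
    value property on discs (osclap_disc_mean) turns the supremum into
    a mean of |F'|^2 over a Whitney region around the upper half. A regular
    weight is essentially constant on such a region, so
    |F| <= 2 \sum_S G_S 1_S, where rho(c_S) G_S^2 is a constant times the
    integral of |F'|^2 rho over the region of S (norm_le_majorant). As the
    regions have bounded overlap (sum_integral_whitney), the sum N of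
    rho(c_S) G_S^2 is at most a constant times the squared norm of F.

    The inequality for sums. It remains to bound the integral of
    (\sum_S G_S 1_S)^2 with respect to mu by a multiple of N (tree_embedding).
    Let m_S bound mu(S) and let Phi_S be the sum of the G_T over the boxes T
    that contain S. Ordering the pairs of boxes of a chain gives the bound 2 X
    with X = \sum_S G_S Phi_S m_S, and in the same way
    Phi_S^2 <= 2 \sum_(T contains S) G_T Phi_T. If the packing condition
    \sum_(T inside S) m_T^2 / rho(c_T) <= A m_S holds, the latter gives
    \sum_S Phi_S^2 m_S^2 / rho(c_S) <= 2 A X, and the inequality of arithmetic
    and geometric means gives X <= A N + X / 2, that is X <= 2 A N.

    Packing is the testing condition (testing_packing): for z in a fixed portion
    of the upper half of T, the closed box of T is contained in Q(z), so the
    integrand of the testing condition is there at least a constant times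
    m_T^2 / (4^k rho(c_T)), and this portion has area 4^k / 8. *)

(** * Integrals of nonnegative functions *)

(** The integral of a nonnegative function is the supremum over the simple
    functions below it, hence monotone on all nonnegative functions; the upper
    bounds that occur here are not known to be measurable. *)
Lemma ge0_le_integral_any d (T : measurableType d) (R : realType)
    (mu : {measure set T -> \bar R}) (D : set T) (f g : T -> \bar R) :
  (forall x, D x -> 0 <= f x)%E -> (forall x, D x -> f x <= g x)%E ->
  (\int[mu]_(x in D) f x <= \int[mu]_(x in D) g x)%E.
Proof.
move=> f0 fg.
rewrite [leLHS]ge0_integralE// [leRHS]ge0_integralE//; last first.
  by move=> x Dx; exact: le_trans (f0 _ Dx) (fg _ Dx).
apply: le_ereal_sup => _ [h hf <-]; exists h => // x.
apply: (le_trans (hf x)); rewrite /patch; case: ifPn => // /set_mem; exact: fg.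
Qed.

Lemma sum_measure_le_integral d (T : measurableType d) (R : realType)
    (mu : {measure set T -> \bar R}) (I : finType) (P : pred I)
    (E : I -> set T) (D : set T) (c : I -> R) (g : T -> \bar R) :
  measurable D -> (forall i, measurable (E i)) -> (forall i, 0 <= c i) ->
  (forall i j z, E i z -> E j z -> i = j) ->
  (forall i, P i -> E i `<=` D) ->
  (forall z, D z -> 0 <= g z)%E ->
  (forall i z, P i -> E i z -> (c i)%:E <= g z)%E ->
  (\sum_(i | P i) (c i)%:E * mu (E i) <= \int[mu]_(z in D) g z)%E.
Proof.
move=> mD mE c0 disj ED g0 cg.
apply: (@le_trans _ _ (\int[mu]_(z in D) \sum_(i | P i) (c i * \1_(E i) z)%:E)%E).
  rewrite -big_filter; under [leRHS]eq_integral do rewrite -big_filter.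
  rewrite ge0_integral_sum//.
  - rewrite !big_filter; apply: lee_sum => i Pi.
    under eq_integral do rewrite EFinM.
    rewrite ge0_integralZl//; last by rewrite lee_fin.
      by rewrite integral_indic// setIidl//; exact: ED.
    exact/measurable_EFinP.
  - by move=> i; apply/measurable_EFinP; exact: measurable_funM.
  - by move=> i z _; rewrite lee_fin mulr_ge0.
apply: ge0_le_integral_any => z Dz.
  by apply: sume_ge0 => i _; rewrite lee_fin mulr_ge0.
have [[i [Pi Ei]]|nE] := pselect (exists i, P i /\ E i z).
  rewrite (bigD1 i)//= big1 ?adde0.
    by rewrite indicE mem_set// mulr1; exact: cg.
  move=> j /andP[_ ji]; rewrite indicE memNset ?mulr0// => Ej.
  by move/eqP: ji; apply; exact: disj Ej Ei.
rewrite big1 ?g0// => i Pi; rewrite indicE memNset ?mulr0// => Ei.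
by apply: nE; exists i.
Qed.

(** * An energy inequality on forests *)

Section tree_sum.
Context (R : realType) (I : finType) (le : rel I).
Hypothesis le_chain : forall i j l, le i j -> le i l -> le j l || le l j.
Variables (G r m : I -> R) (A : R).
Hypotheses (G0 : forall i, 0 <= G i) (r0 : forall i, 0 < r i) (A0 : 0 < A).
Hypothesis packing :
  forall i, \sum_(j | le j i) m j ^+ 2 / r j <= A * m i.

Let Phi i := \sum_(j | le i j) G j.

Let Phi0 i : 0 <= Phi i. Proof. exact: sumr_ge0. Qed.

(** In a chain, each product [G j * G l] occurs in the sum over the pairs with
    [le j l] or in the equal sum over the pairs with [le l j]; completing the
    inner sum to [Phi j] only enlarges it. *)
Lemma sum_pairs_chain (P : pred I) :
  (forall j l, P j -> P l -> le j l || le l j) ->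
  (\sum_(j | P j) G j) ^+ 2 <= 2 * \sum_(j | P j) G j * Phi j.
Proof.
move=> chain.
have -> : (\sum_(j | P j) G j) ^+ 2 = \sum_(j | P j) \sum_(l | P l) G j * G l.
  by rewrite expr2 mulr_suml; apply: eq_bigr => j _; rewrite mulr_sumr.
pose T := \sum_(j | P j) \sum_(l | P l) G j * G l *+ le j l.
(* [T] lists the pairs with the smaller index first. *)
have T_swap : \sum_(j | P j) \sum_(l | P l) G j * G l *+ le l j = T.
  by rewrite exchange_big; apply: eq_bigr => j _; apply: eq_bigr => l _; rewrite mulrC.
apply: (@le_trans _ _ (T + T)).
  rewrite -{2}T_swap -big_split/=; apply: ler_sum => j Pj.
  rewrite -big_split/=; apply: ler_sum => l Pl.
  have := chain j l Pj Pl; have GG : 0 <= G j * G l by rewrite mulr_ge0.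
  case: (le j l) => /= [_|->]; last by rewrite mulr0n add0r.
  by rewrite lerDl mulrn_wge0.
rewrite -mulr2n mulr_natl lerMn2r /=; apply: ler_sum => j Pj.
rewrite /Phi mulr_sumr [X in _ <= X]big_mkcond [X in X <= _]big_mkcond/=.
apply: ler_sum => l _; have GG : 0 <= G j * G l by rewrite mulr_ge0.
by case: (P l); case: (le j l).
Qed.

(** The energy [X] on the left reproduces itself: expanding [Phi i ^+ 2] along
    the chain above [i] and summing the packing condition bounds the sum [Y]
    of the [Phi i ^+ 2 * (m i ^+ 2 / r i)] by [2 * A * X], while [X <= A * N +
    Y / (4 * A)] for the sum [N] of the [r i * G i ^+ 2]. *)
Lemma tree_energy_le :
  \sum_i G i * Phi i * m i <= 2 * A * \sum_i r i * G i ^+ 2.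
Proof.
set X := \sum_i _; set N := \sum_i _.
pose Y := \sum_i Phi i ^+ 2 * (m i ^+ 2 / r i).
have YX : Y <= 2 * A * X.
  apply: (@le_trans _ _ (\sum_i (2 * \sum_(j | le i j) G j * Phi j) * (m i ^+ 2 / r i))).
    apply: ler_sum => i _; apply: ler_wpM2r.
      by rewrite divr_ge0 ?sqr_ge0 ?ltW.
    by apply: sum_pairs_chain => j l; exact: le_chain.
  have -> : \sum_i (2 * \sum_(j | le i j) G j * Phi j) * (m i ^+ 2 / r i) =
      2 * \sum_j G j * Phi j * \sum_(i | le i j) m i ^+ 2 / r i.
    rewrite mulr_sumr.
    under eq_bigr do rewrite mulrAC mulr_sumr big_mkcond/=.
    rewrite exchange_big; apply: eq_bigr => j _.
    rewrite !mulr_sumr [RHS]big_mkcond/=; apply: eq_bigr => i _.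
    by case: ifP => // _; ring.
  rewrite -mulrA ler_pM2l// /X mulr_sumr; apply: ler_sum => j _.
  rewrite [leRHS](_ : _ = G j * Phi j * (A * m j)); last by ring.
  by apply: ler_wpM2l => //; rewrite mulr_ge0.
(* The difference of the two sides is a sum of squares. *)
have XNY : X <= A * N + (4 * A)^-1 * Y.
  rewrite /X /N /Y !mulr_sumr -big_split/=; apply: ler_sum => i _.
  have r_neq0 : r i != 0 by rewrite gt_eqF.
  have A_neq0 : A != 0 by rewrite gt_eqF.
  rewrite -subr_ge0.
  rewrite (_ : _ - _ = (A * r i)^-1 * (A * r i * G i - Phi i * m i / 2) ^+ 2).
    by rewrite mulr_ge0 ?sqr_ge0// invr_ge0 mulr_ge0// ltW.
  by field; rewrite A_neq0 r_neq0.
have : (4 * A)^-1 * Y <= X / 2.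
  have A_neq0 : A != 0 by rewrite gt_eqF.
  rewrite (_ : X / 2 = (4 * A)^-1 * (2 * A * X)); last by field.
  by apply: ler_wpM2l => //; rewrite invr_ge0 mulr_ge0 ?ltW.
by lra.
Qed.

End tree_sum.

(** The sets [S i] through a point form a chain for [le], so the square of the
    sum expands as in [sum_pairs_chain] and integrates to twice the energy of
    [tree_energy_le]. The masses [m i] are only upper bounds of [mu (S i)], so
    that half-open sets can be paired with the masses of their closures. *)
Lemma tree_embedding d (T : measurableType d) (R : realType)
    (mu : {measure set T -> \bar R}) (I : finType) (le : rel I)
    (S : I -> set T) (G r m : I -> R) (A : R) :
  (forall i j l, le i j -> le i l -> le j l || le l j) ->
  (forall z i j, S i z -> S j z -> le i j || le j i) ->
  (forall i, measurable (S i)) ->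
  (forall i, 0 <= G i) -> (forall i, 0 < r i) -> 0 < A ->
  (forall i, mu (S i) <= (m i)%:E)%E ->
  (forall i, \sum_(j | le j i) m j ^+ 2 / r j <= A * m i) ->
  (\int[mu]_z ((\sum_i G i * \1_(S i) z) ^+ 2)%:E <=
     (4 * A * \sum_i r i * G i ^+ 2)%:E)%E.
Proof.
move=> le_chain S_chain mS G0 r0 A0 muS packing.
pose Phi i := \sum_(j | le i j) G j.
have GPhi0 i : 0 <= 2 * (G i * Phi i).
  by rewrite !mulr_ge0//; apply: sumr_ge0.
apply: (@le_trans _ _ (\int[mu]_z \sum_i (2 * (G i * Phi i) * \1_(S i) z)%:E)%E).
  apply: ge0_le_integral => //.
  - by move=> z _; rewrite lee_fin sqr_ge0.
  - apply/measurable_EFinP; apply: measurable_funX.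
    by apply: measurable_sum => i; exact: measurable_funM.
  - by apply: emeasurable_sum => i; apply/measurable_EFinP; exact: measurable_funM.
  - move=> z _; rewrite sumEFin lee_fin.
    have -> : \sum_i G i * \1_(S i) z = \sum_(i | z \in S i) G i.
      by rewrite [RHS]big_mkcond; apply: eq_bigr => i _; rewrite indicE;
        case: (z \in S i); rewrite ?mulr1 ?mulr0.
    have -> : \sum_i 2 * (G i * Phi i) * \1_(S i) z =
        2 * \sum_(i | z \in S i) G i * Phi i.
      rewrite mulr_sumr [RHS]big_mkcond; apply: eq_bigr => i _; rewrite indicE.
      by case: (z \in S i); rewrite ?mulr1 ?mulr0.
    apply: sum_pairs_chain => // j l /set_mem Sj /set_mem Sl.
    exact: S_chain Sj Sl.
rewrite ge0_integral_sum//.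
- rewrite (@le_trans _ _ (2 * \sum_i G i * Phi i * m i)%:E)//.
    rewrite mulr_sumr -sumEFin; apply: lee_sum => i _.
    under eq_integral do rewrite EFinM.
    rewrite ge0_integralZl//; last by rewrite lee_fin.
      rewrite integral_indic// setIT.
      rewrite (@le_trans _ _ ((2 * (G i * Phi i))%:E * (m i)%:E)%E)//.
        by rewrite lee_wpmul2l ?lee_fin.
      by rewrite -EFinM !mulrA.
    by apply/measurable_EFinP.
  rewrite lee_fin (_ : 4 * A * _ = 2 * (2 * A * \sum_i r i * G i ^+ 2)); last by ring.
  rewrite ler_wpM2l//; exact: tree_energy_le.
- by move=> i; apply/measurable_EFinP; exact: measurable_funM.
- by move=> i z _; rewrite lee_fin mulr_ge0.
Qed.

(** * Dyadic cells of the half-plane *)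

Section dyadic.
Context {R : realType}.
Implicit Types (i j k : int) (q : int * int) (z : plane R).

Definition side k : R := 2 ^ k.

Lemma side_gt0 k : 0 < side k. Proof. exact: exprz_gt0. Qed.

Lemma side_pred k : side (k - 1) = side k / 2.
Proof. by rewrite /side expfzDr//. Qed.

Lemma side_mul k k' : k <= k' -> exists n : int, side k' = n%:~R * side k.
Proof.
move=> kk'; exists (2 ^+ `|k' - k|).
rewrite rmorphXn/= exprnP /side.
rewrite gez0_abs ?subr_ge0//.
by rewrite -expfzDr// subrK.
Qed.

Definition lo q : R := q.2%:~R * side q.1.

Definition centre q : plane R := (side q.1 / 2, lo q + side q.1 / 2).

Definition dbox q : set (plane R) :=
  [set z | 0 < z.1 < side q.1 /\ lo q <= z.2 < lo q + side q.1].

Definition dtop q : set (plane R) :=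
  [set z | side q.1 / 2 <= z.1 < side q.1 /\ lo q <= z.2 < lo q + side q.1].

(** Contains the disc of radius [side q.1 / 4] around each point of [dtop q],
    and stays at a distance from the boundary of the half-plane comparable
    with its size. *)
Definition whitney q : set (plane R) :=
  [set z | side q.1 / 4 <= z.1 <= 5 / 4 * side q.1 /\
           `|z.2 - (centre q).2| <= 3 / 4 * side q.1].

(** Inclusion of the boxes, read off the corners so that it is decidable. *)
Definition dle q q' : bool :=
  [&& q.1 <= q'.1, lo q' <= lo q & lo q + side q.1 <= lo q' + side q'.1].

(** The endpoints of both intervals are integer multiples of the shorter side,
    so overlapping intervals are nested. *)
Lemma dyadic_nested q q' (y : R) : q.1 <= q'.1 ->
  lo q <= y < lo q + side q.1 -> lo q' <= y < lo q' + side q'.1 -> dle q q'.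
Proof.
case: q q' => [k j] [k' j']; rewrite /dle /lo/= => kk' /andP[jy yj] /andP[j'y yj'].
rewrite kk'/=; have [n nE] := side_mul kk'; rewrite nE in j'y yj' *.
have s0 := side_gt0 k.
have : j'%:~R * n%:~R < (j + 1)%:~R :> R.
  rewrite -(ltr_pM2r s0) (le_lt_trans (_ : _ <= y))//; first by rewrite -mulrA.
  by rewrite rmorphD/= mulrDl mul1r.
have : j%:~R < (j' + 1)%:~R * n%:~R :> R.
  rewrite -(ltr_pM2r s0) (le_lt_trans jy)// (lt_le_trans yj')//.
  by rewrite rmorphD/= !mulrDl !mul1r mulrA.
rewrite -!rmorphM !ltr_int => jn nj.
have {}nj : j' * n <= j by lia.
have {}jn : j + 1 <= j' * n + n by lia.
apply/andP; split.
  by rewrite mulrA ler_pM2r// -intrM ler_int.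
rewrite mulrA -mulrDl -{2}[side k]mul1r -mulrDl ler_pM2r//.
by rewrite -intrM -(intrD _ j 1) -intrD ler_int.
Qed.

Lemma dle_chain q q1 q2 : dle q q1 -> dle q q2 -> dle q1 q2 || dle q2 q1.
Proof.
move=> /and3P[_ q1q qq1] /and3P[_ q2q qq2].
have lo1 : lo q1 <= lo q < lo q1 + side q1.1.
  by rewrite q1q (lt_le_trans _ qq1)// ltrDl side_gt0.
have lo2 : lo q2 <= lo q < lo q2 + side q2.1.
  by rewrite q2q (lt_le_trans _ qq2)// ltrDl side_gt0.
have [kk|/ltW kk] := leP q1.1 q2.1; apply/orP.
  by left; exact: dyadic_nested lo1 lo2.
by right; exact: dyadic_nested lo2 lo1.
Qed.

Lemma dbox_chain z q1 q2 : dbox q1 z -> dbox q2 z -> dle q1 q2 || dle q2 q1.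
Proof.
move=> [_ z1] [_ z2].
have [kk|/ltW kk] := leP q1.1 q2.1; apply/orP.
  by left; exact: dyadic_nested z1 z2.
by right; exact: dyadic_nested z2 z1.
Qed.

Lemma lo_inj k j j' (y : R) : lo (k, j) <= y < lo (k, j) + side k ->
  lo (k, j') <= y < lo (k, j') + side k -> j = j'.
Proof.
move=> y1 y2.
have /and3P[_ /= h1 _] := @dyadic_nested (k, j) (k, j') y (lexx _) y1 y2.
have /and3P[_ /= h2 _] := @dyadic_nested (k, j') (k, j) y (lexx _) y2 y1.
have : lo (k, j) = lo (k, j') by apply/eqP; rewrite eq_le h1 h2.
move/(mulIf (lt0r_neq0 (side_gt0 k)))=> /=.
exact: intr_inj.
Qed.

Lemma side_lt k k' : (side k < side k') = (k < k').
Proof. by rewrite /side ltr_eXz2l// ltr1n. Qed.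

(** The abscissas of an upper half determine the scale of its box, and the
    ordinates then determine the position. *)
Lemma dtop_inj z q1 q2 : dtop q1 z -> dtop q2 z -> q1 = q2.
Proof.
case: q1 q2 => [k1 j1] [k2 j2] [/andP[/= z1 z1'] z1y] [/andP[/= z2 z2'] z2y].
have k12 : k1 = k2.
  apply/eqP; rewrite eq_le; apply/andP; split; rewrite leNgt; apply/negP => kk.
  - have : side k2 <= side (k1 - 1) by rewrite leNgt side_lt; lia.
    by rewrite side_pred; lra.
  - have : side k1 <= side (k2 - 1) by rewrite leNgt side_lt; lia.
    by rewrite side_pred; lra.
by subst k2; congr (_, _); exact: lo_inj z1y z2y.
Qed.

Lemma dbox_Qbox q : dbox q `<=` Qbox (centre q).
Proof.
move=> [x y] [/= /andP[x0 xs] /andP[y1 y2]]; split => /=; last first.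
  by rewrite ler_norml; apply/andP; split; lra.
by rewrite x0/=; lra.
Qed.

Lemma arcosh_le (u v : R) : 1 <= u -> u <= v -> arcosh u <= ln (2 * v).
Proof.
move=> u1 uv; rewrite /arcosh.
have u0 : 0 < u by rewrite (lt_le_trans ltr01).
have su : Num.sqrt (u ^+ 2 - 1) <= u.
  rewrite -[leRHS](ger0_norm (ltW u0)) -sqrtr_sqr ler_sqrt ?sqr_ge0//.
  by rewrite lerBlDr lerDl.
rewrite ler_ln ?posrE//; last 2 first.
- by rewrite ltr_pwDl ?sqrtr_ge0.
- by rewrite mulr_gt0// (lt_le_trans u0).
by lra.
Qed.

Lemma whitney_Cplus q : whitney q `<=` @Cplus R.
Proof.
move=> z [/andP[z1 _] _]; have := side_gt0 q.1.
by rewrite /Cplus/=; lra.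
Qed.

Lemma centre_Cplus q : Cplus (centre q).
Proof. by have := side_gt0 q.1; rewrite /Cplus/=; lra. Qed.

Lemma dH_sym (z w : plane R) : dH z w = dH w z.
Proof.
by rewrite /dH; congr (arcosh (1 + _ / _)); ring.
Qed.

(** On a Whitney region the quotient in [dH] is at most [9 / 2], whatever the
    scale, and [arcosh u <= ln (2 * u)]. *)
Lemma dH_whitney q z : whitney q z -> dH z (centre q) <= ln 11.
Proof.
case: z => [x y]; set s := side q.1 => -[/= /andP[x1 x2]]; rewrite ler_norml => /andP[y1 y2].
have s0 : 0 < s by exact: side_gt0.
rewrite -/s in x1 x2 y1 y2.
rewrite /dH/= -/s (_ : 11 = 2 * (1 + 9/2)); last by lra.
have x0 : 0 < x by lra.
have den0 : 0 < 2 * x * (s / 2) by rewrite !mulr_gt0.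
set Y := y - _ in y1 y2 *.
have Y2 : Y ^+ 2 <= (3 / 4 * s) ^+ 2.
  by rewrite -real_normK ?num_real// lerXn2r ?nnegrE//; [lra|rewrite ler_norml; lra].
have X2 : (x - s / 2) ^+ 2 <= (3 / 4 * s) ^+ 2.
  by rewrite -real_normK ?num_real// lerXn2r ?nnegrE//; [lra|rewrite ler_norml; lra].
apply: arcosh_le.
  by rewrite lerDl divr_ge0 ?addr_ge0 ?sqr_ge0// ltW.
rewrite lerD2l ler_pdivrMr//.
by nra.
Qed.

End dyadic.

Arguments dle R q q' : clear implicits.

(** * Packing of the dyadic cells *)

Section packing.
Context {R : realType}.
Implicit Types (q : int * int) (z : plane R).

Lemma regular_weight_whitney (rho : plane R -> R) : regular_weight rho ->
  exists2 delta : R, 0 < delta & forall q z, whitney q z ->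
    rho z <= delta * rho (centre q) /\ rho (centre q) <= delta * rho z.
Proof.
move=> [_ _ reg].
have /reg[delta delta0 rhoP] : 0 < ln (11 : R) by rewrite ln_gt0// ltr1n.
exists delta => // q z qz; have zC := whitney_Cplus qz; have cC := @centre_Cplus R q.
by split; apply: rhoP => //; last rewrite dH_sym; exact: dH_whitney.
Qed.

(** The part of the upper half of the box whose points [z] satisfy [Qbox
    (centre q) `<=` Qbox z]. *)
Definition core q : set (plane R) :=
  `[3 / 4 * side q.1, side q.1[ `*`
  `[lo q + side q.1 / 4, lo q + 3 / 4 * side q.1].

Lemma measurable_core q : measurable (core q).
Proof. by apply: measurableX; exact: measurable_itv. Qed.

Lemma area_core q : area R (core q) = (side q.1 ^+ 2 / 8)%:E.
Proof.
have s0 := @side_gt0 R q.1.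
transitivity ((side q.1 / 4 : R)%:E * (side q.1 / 2 : R)%:E)%E.
  have -> : area R (core q) =
      (@lebesgue_measure R `[(3 / 4 * side q.1)%R, side q.1[%classic *
       @lebesgue_measure R `[(lo q + side q.1 / 4)%R, (lo q + 3 / 4 * side q.1)%R]%classic)%E.
    by apply: product_measure1E; exact: measurable_itv.
  congr (_ * _)%E; rewrite lebesgue_measure_itv/= lte_fin.
    by rewrite ifT; [rewrite -EFinB; congr EFin; field|lra].
  by rewrite ifT; [rewrite -EFinB; congr EFin; field|lra].
by rewrite -EFinM; congr EFin; field.
Qed.

Lemma core_dtop q : core q `<=` dtop q.
Proof.
move=> [x y] [/=]; rewrite !in_itv/= => /andP[x1 x2] /andP[y1 y2].
have s0 := @side_gt0 R q.1.
by split => /=; apply/andP; split; lra.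
Qed.

Lemma core_whitney q : core q `<=` whitney q.
Proof.
move=> [x y] [/=]; rewrite !in_itv/= => /andP[x1 x2] /andP[y1 y2].
have s0 := @side_gt0 R q.1.
split => /=; first by apply/andP; split; lra.
by rewrite ler_norml; apply/andP; split; lra.
Qed.

Lemma dle_Qbox q q' : dle R q q' -> Qbox (centre q) `<=` Qbox (centre q' : plane R).
Proof.
move=> /and3P[kk l1 l2] [x y] [/= /andP[x0 xs]]; rewrite ler_norml => /andP[y1 y2].
have ss : side q.1 <= side q'.1 :> R by rewrite leNgt side_lt; lia.
split => /=; first by rewrite x0; lra.
by rewrite ler_norml; apply/andP; split; lra.
Qed.

Lemma core_Qbox q : core q `<=` Qbox (centre q).
Proof.
move=> [x y] [/=]; rewrite !in_itv/= => /andP[x1 x2] /andP[y1 y2].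
have s0 := @side_gt0 R q.1.
split => /=; first by apply/andP; split; lra.
by rewrite ler_norml; apply/andP; split; lra.
Qed.

Lemma Qbox_core q z : core q z -> Qbox (centre q) `<=` Qbox z.
Proof.
case: z => [x y] [/=]; rewrite !in_itv/= => /andP[x1 x2] /andP[y1 y2].
have s0 := @side_gt0 R q.1.
move=> [u v] [/= /andP[u0 u1]]; rewrite ler_norml => /andP[v1 v2].
split => /=; first by rewrite u0; lra.
by rewrite ler_norml; apply/andP; split; lra.
Qed.

Lemma measurable_Qbox (a : plane R) : measurable (Qbox a).
Proof.
rewrite (_ : Qbox a = `]0, (2 * a.1)] `*` `[(a.2 - a.1), (a.2 + a.1)]).
  by apply: measurableX; exact: measurable_itv.
apply/seteqP; split => -[x y]; rewrite /Qbox/= !in_itv/= ler_norml.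
  by move=> [-> /andP[? ?]]; split => //; apply/andP; split; lra.
by move=> [-> /andP[? ?]]; split => //; apply/andP; split; lra.
Qed.

Variables (rho : plane R -> R) (mu : {measure set (plane R) -> \bar R}).
Variables (delta C : R).
Hypothesis rho0 : forall z, Cplus z -> 0 < rho z.
Hypothesis delta0 : 0 < delta.
Hypothesis rhoP : forall q z, whitney q z -> rho z <= delta * rho (centre q).
Hypothesis mu_fin : forall a, Cplus a -> (mu (Qbox a) < +oo)%E.
Hypothesis testing : forall a, Cplus a ->
  (\int[@area R]_(z in Qbox a)
     ((mu (Qbox a `&` Qbox z) / (z.1)%:E) ^+ 2 * ((rho z)^-1)%:E)
   <= C%:E * mu (Qbox a))%E.

Definition mass q : R := fine (mu (Qbox (centre q))).

Lemma massE q : mu (Qbox (centre q)) = (mass q)%:E.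
Proof.
rewrite fineK// ge0_fin_numE//; apply: mu_fin; exact: centre_Cplus.
Qed.

(** Test at the centre of the large box. The cores of the smaller boxes are
    disjoint, and on the core of [j] the set [Qbox a `&` Qbox z] contains the
    closed box of [j]; the core has area [side ^+ 2 / 8], whence the factor 8. *)
Lemma testing_packing (I : finType) (idx : I -> int * int) (i : I) :
  injective idx ->
  \sum_(j | dle R (idx j) (idx i)) mass (idx j) ^+ 2 / rho (centre (idx j)) <=
    8 * delta * C * mass (idx i).
Proof.
move=> window_inj.
have rc q : 0 < rho (centre q) by apply: rho0; exact: centre_Cplus.
pose c j := (mass (idx j) / side (idx j).1) ^+ 2 / (delta * rho (centre (idx j))).
suff : (\sum_(j | dle R (idx j) (idx i)) (c j)%:E * area R (core (idx j)) <= C%:E * (mass (idx i))%:E)%E.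
  under eq_bigr do rewrite area_core -EFinM.
  rewrite sumEFin -EFinM lee_fin => le_C.
  rewrite (_ : 8 * _ * _ * _ = 8 * delta * (C * mass (idx i))); last by ring.
  rewrite -ler_pdivrMl ?mulr_gt0//; apply: le_trans le_C.
  rewrite mulr_sumr; apply: ler_sum => j _; rewrite /c le_eqVlt; apply/orP; left; apply/eqP.
  have s0 : side (idx j).1 != 0 :> R by rewrite lt0r_neq0 ?side_gt0.
  by field; rewrite s0 !lt0r_neq0.
rewrite -massE; apply: le_trans (testing (@centre_Cplus R (idx i))).
apply: sum_measure_le_integral.
- exact: measurable_Qbox.
- by move=> j; exact: measurable_core.
- by move=> j; rewrite divr_ge0 ?sqr_ge0// ltW// mulr_gt0.
- move=> j j' z /core_dtop zj /core_dtop zj'; apply: window_inj; exact: dtop_inj zj zj'.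
- by move=> j ji; apply: subset_trans (@core_Qbox _) _; exact: dle_Qbox.
- move=> z [/andP[z0 _] _]; rewrite mule_ge0//.
    by rewrite expe2 sqre_ge0.
  by rewrite lee_fin invr_ge0 ltW// rho0.
- move=> j z ji jz.
  have zW := core_whitney jz; have zC := whitney_Cplus zW.
  have s0 : 0 < side (idx j).1 :> R by exact: side_gt0.
  have z1s : z.1 <= side (idx j).1.
    by case: jz => /=; rewrite in_itv/= => /andP[_ /ltW].
  have cz : ((mass (idx j) / z.1)%:E <= mu (Qbox (centre (idx i)) `&` Qbox z) / (z.1)%:E)%E.
    rewrite inver gt_eqF// EFinM.
    apply: lee_wpmul2r; first by rewrite lee_fin invr_ge0 ltW.
    rewrite -massE le_measure ?inE//; [exact: measurable_Qbox|by apply: measurableI; exact: measurable_Qbox|].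
    by move=> w jw; split; [exact: dle_Qbox jw|exact: Qbox_core jw].
  have m0 : 0 <= mass (idx j) by rewrite fine_ge0.
  have le_X : ((mass (idx j) / side (idx j).1)%:E <=
      mu (Qbox (centre (idx i)) `&` Qbox z) / (z.1)%:E)%E.
    apply: le_trans cz; rewrite lee_fin ler_wpM2l// lef_pV2 ?posrE//.
  have X0 : 0 <= mass (idx j) / side (idx j).1 by rewrite divr_ge0// ltW.
  rewrite /c EFinM; apply: lee_pmul.
  + by rewrite lee_fin sqr_ge0.
  + by rewrite lee_fin invr_ge0 ltW// mulr_gt0.
  + by rewrite expr2 EFinM expe2 lee_pmul.
  + by rewrite lee_fin lef_pV2 ?posrE ?mulr_gt0// ?rhoP// rho0.
Qed.

End packing.

(** * Overlap of the Whitney regions *)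

Section overlap.
Context {R : realType}.
Implicit Types (q : int * int) (z : plane R).

Lemma measurable_whitney q : measurable (whitney q : set (plane R)).
Proof.
rewrite (_ : whitney q = `[side q.1 / 4, 5 / 4 * side q.1] `*`
    `[(centre q).2 - 3 / 4 * side q.1, (centre q).2 + 3 / 4 * side q.1]).
  by apply: measurableX; exact: measurable_itv.
apply/seteqP; split => -[x y]; rewrite /whitney/= !in_itv/= ler_norml.
  by move=> [-> /andP[? ?]]; split => //; apply/andP; split; lra.
by move=> [-> /andP[? ?]]; split => //; apply/andP; split; lra.
Qed.

Lemma measurable_Cplus : measurable (@Cplus R).
Proof.
rewrite (_ : @Cplus R = `]0, +oo[ `*` setT).
  by apply: measurableX; [exact: measurable_itv|exact: measurableT].
by apply/seteqP; split => -[x y]; rewrite /Cplus/= in_itv/= andbT// => -[].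
Qed.

(** Two Whitney regions that meet have scales [k] differing by at most 2 and,
    at equal scales, positions [j] differing by at most 1. Residues modulo 3
    and 2 therefore separate the regions through a point, which bounds their
    number by 6. *)
Lemma whitney_same_mod q q' z : whitney q z -> whitney q' z ->
  (q.1 == q'.1 %[mod 3])%Z -> (q.2 == q'.2 %[mod 2])%Z -> q = q'.
Proof.
have le3 (a b : int * int) : whitney a z -> whitney b z -> a.1 < b.1 + 3.
  move=> [/andP[a1 a2] _] [/andP[b1 b2] _]; rewrite ltNge; apply/negP => ba.
  have : side (b.1 + 3) <= side a.1 :> R by rewrite leNgt side_lt; lia.
  have -> : side (b.1 + 3) = side b.1 * 8 :> R by rewrite /side expfzDr// -exprnP; congr (_ * _); ring.
  by have := @side_gt0 R b.1; lra.
move=> qz q'z k3 j2.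
have k : q.1 = q'.1.
  by have := le3 _ _ qz q'z; have := le3 _ _ q'z qz; lia.
case: q q' => [k0 j] [k' j'] in qz q'z k3 j2 k *; rewrite /= in k j2; subst k'.
congr (_, _).
case: qz q'z => [_ /=]; rewrite ler_norml /lo/= => /andP[a1 a2] [_ /=].
rewrite ler_norml /lo/= => /andP[b1 b2].
have s0 := @side_gt0 R k0.
have : (j - j')%:~R * side k0 < 2%:~R * side k0 :> R by rewrite intrB mulrBl; lra.
rewrite ltr_pM2r// ltr_int => jj'.
have : (j' - j)%:~R * side k0 < 2%:~R * side k0 :> R by rewrite intrB mulrBl; lra.
rewrite ltr_pM2r// ltr_int => j'j.
lia.
Qed.

Lemma whitney_overlap (I : finType) (idx : I -> int * int) z : injective idx ->
  \sum_i \1_(whitney (idx i)) z <= 6 :> R.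
Proof.
move=> window_inj.
pose A := [set i : I | `[< whitney (idx i) z >]]%SET.
have -> : \sum_i \1_(whitney (idx i)) z = #|A|%:R :> R.
  rewrite -sum1_card natr_sum [RHS]big_mkcond; apply: eq_bigr => i _.
  rewrite indicE inE /=; case: asboolP => [/mem_set ->//|W]; by rewrite memNset.
pose f i : 'I_3 * 'I_2 :=
  (inord `|((idx i).1 %% 3)%Z|, inord `|((idx i).2 %% 2)%Z|).
suff f_inj : {in A &, injective f}.
  rewrite -(card_in_imset f_inj) ler_nat.
  by apply: (leq_trans (max_card _)); rewrite card_prod !card_ord.
move=> i j; rewrite !inE => iz jz [/(congr1 val) e1 /(congr1 val) e2].
apply: window_inj; apply: (whitney_same_mod iz jz).
  by move: e1; rewrite /= !inordK; lia.
by move: e2; rewrite /= !inordK; lia.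
Qed.

Lemma sum_integral_whitney (I : finType) (idx : I -> int * int) (phi : plane R -> \bar R) :
  injective idx -> measurable_fun (@Cplus R) phi ->
  (forall z, Cplus z -> 0 <= phi z)%E ->
  (\sum_i \int[@area R]_(z in whitney (idx i)) phi z <=
     6 * \int[@area R]_(z in @Cplus R) phi z)%E.
Proof.
move=> window_inj mphi phi0; have mC := measurable_Cplus.
have -> : (\sum_i \int[@area R]_(z in whitney (idx i)) phi z =
    \int[@area R]_(z in @Cplus R) \sum_i (phi z * (\1_(whitney (idx i)) z)%:E))%E.
  rewrite ge0_integral_sum//.
  - apply: eq_bigr => i _.
    rewrite -[in LHS](setIidr (@whitney_Cplus R (idx i))) integral_mkcondr.
    by rewrite epatch_indic.
  - move=> i; apply: emeasurable_funM => //.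
    apply/measurable_EFinP; apply: measurable_funTS; apply: measurable_indic.
    exact: measurable_whitney.
  - by move=> i z zC; rewrite mule_ge0 ?lee_fin ?phi0.
rewrite -ge0_integralZl// ?lee_fin//.
apply: ge0_le_integral_any => z zC.
  by apply: sume_ge0 => i _; rewrite mule_ge0 ?lee_fin ?phi0.
rewrite -ge0_sume_distrr; last by move=> i _; rewrite lee_fin.
rewrite muleC lee_wpmul2r ?phi0// sumEFin lee_fin.
exact: whitney_overlap.
Qed.

End overlap.

(** * Second-order estimates of exponentials *)

Section elementary.
Context {R : realType}.
Implicit Types u v x : R.

(** The mean value theorem on the segment between 0 and [x], on either side of
    0. *)
Lemma increment_le (f df : R -> R) (M x : R) :
  (forall y : R, is_derive y 1 f (df y)) ->
  (forall y, `|y| <= `|x| -> `|df y| <= M) -> `|f x - f 0| <= M * `|x|.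
Proof.
move=> fD dfM.
have cf (A : set R) : {within A, continuous f}.
  apply: continuous_subspaceT => y; apply: differentiable_continuous.
  by apply/derivable1_diffP; exact: ex_derive.
have [x0|x0] := leP 0 x.
  have [c + ->] := MVT_segment x0 (fun y _ => fD y) (cf _).
  rewrite in_itv/= subr0 normrM => /andP[c0 cx].
  by rewrite ler_wpM2r// dfM// !ger0_norm.
have [c + E] := MVT_segment (ltW x0) (fun y _ => fD y) (cf _).
rewrite in_itv/= => /andP[xc c0].
rewrite distrC E sub0r normrM normrN ler_wpM2r// dfM//.
by rewrite (ler0_norm c0) (ler0_norm (ltW x0)) lerN2.
Qed.

Lemma norm_sin_le x : `|sin x| <= `|x|.
Proof.
have := @increment_le sin cos 1 x (fun y => is_derive_sin y) (fun y _ => cos_max y).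
by rewrite sin0 subr0 mul1r.
Qed.

Lemma norm_cos_sub1_le x : `|cos x - 1| <= x ^+ 2.
Proof.
have H y : `|y| <= `|x| -> `|- sin y| <= `|x|.
  by move=> yx; rewrite normrN (le_trans (norm_sin_le y)).
have := @increment_le cos (fun y => - sin y) _ x (fun y => is_derive_cos y) H.
by rewrite cos0 -normrM -expr2 normrX real_normK ?num_real.
Qed.

Lemma norm_cos_sub1_le1 x : `|cos x - 1| <= `|x|.
Proof.
have H y : `|y| <= `|x| -> `|- sin y| <= 1 by move=> _; rewrite normrN sin_max.
have := @increment_le cos (fun y => - sin y) _ x (fun y => is_derive_cos y) H.
by rewrite cos0 mul1r.
Qed.

Lemma norm_sin_sub_le x : `|sin x - x| <= x ^+ 2.
Proof.
have H y : `|y| <= `|x| -> `|cos y - 1| <= `|x|.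
  by move=> yx; rewrite (le_trans (norm_cos_sub1_le1 y)).
have D (y : R) : is_derive y 1 (fun z : R => sin z - z) (cos y - 1).
  exact: is_deriveB.
have := increment_le D H.
by rewrite sin0 subrr subr0 -normrM -expr2 normrX real_normK ?num_real.
Qed.

Lemma norm_expR_sub1_le u : `|expR u - 1| <= `|u| * expR `|u|.
Proof.
have H y : `|y| <= `|u| -> `|expR y| <= expR `|u|.
  by move=> yu; rewrite ger0_norm ?expR_ge0// ler_expR (le_trans _ yu)// ler_norm.
by have := increment_le (@is_derive_expR R) H; rewrite expR0 mulrC.
Qed.

Lemma norm_expR_sub1D_le u : `|expR u - 1 - u| <= u ^+ 2 * expR `|u|.
Proof.
have H y : `|y| <= `|u| -> `|expR y - 1| <= `|u| * expR `|u|.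
  move=> yu; rewrite (le_trans (norm_expR_sub1_le y))//.
  by rewrite ler_pM ?expR_ge0// ler_expR.
have D (y : R) : is_derive y 1 (fun z : R => expR z - z) (expR y - 1).
  exact: is_deriveB.
have := increment_le D H.
rewrite expR0 subr0 mulrAC -expr2 real_normK ?num_real//.
by congr (_ <= _); congr `|_|; ring.
Qed.

(** Together with [norm_expsin_le], the second-order bound for [exp (u + i v)]
    near 0, in real and imaginary parts. *)
Lemma norm_expcos_le u v :
  `|expR u * cos v - 1 - u| <= (u ^+ 2 + v ^+ 2) * expR `|u|.
Proof.
rewrite (_ : _ - u = (expR u - 1 - u) + expR u * (cos v - 1)); last by ring.
rewrite (le_trans (ler_normD _ _))// mulrDl lerD ?norm_expR_sub1D_le//.
rewrite normrM (ger0_norm (expR_ge0 _)) mulrC.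
by rewrite ler_pM ?expR_ge0 ?norm_cos_sub1_le ?ler_expR ?ler_norm.
Qed.

Lemma norm_expsin_le u v :
  `|expR u * sin v - v| <= 2 * (u ^+ 2 + v ^+ 2) * expR `|u|.
Proof.
rewrite (_ : _ - v = (expR u - 1) * sin v + (sin v - v)); last by ring.
rewrite (le_trans (ler_normD _ _))// normrM.
have e1 : 1 <= expR `|u| by rewrite -expR0 ler_expR.
have h1 : `|expR u - 1| * `|sin v| <= (u ^+ 2 + v ^+ 2) * expR `|u|.
  apply: (@le_trans _ _ ((`|u| * expR `|u|) * `|v|)).
    by rewrite ler_pM ?norm_expR_sub1_le ?norm_sin_le.
  rewrite mulrAC ler_wpM2r ?expR_ge0//.
  rewrite -(real_normK (num_real u)) -(real_normK (num_real v)).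
  by have := sqr_ge0 (`|u| - `|v|); have := normr_ge0 u; have := normr_ge0 v; nra.
have h2 : `|sin v - v| <= (u ^+ 2 + v ^+ 2) * expR `|u|.
  rewrite (le_trans (norm_sin_sub_le v))// -[leLHS]mulr1 ler_pM ?sqr_ge0//.
  by rewrite lerDr sqr_ge0.
by lra.
Qed.

End elementary.

(** * Real and imaginary parts of Laplace transforms *)

Lemma measurable_cos (R : realType) : measurable_fun [set: R] (@cos R).
Proof. by apply: continuous_measurable_fun; exact: continuous_cos. Qed.

Lemma measurable_sin (R : realType) : measurable_fun [set: R] (@sin R).
Proof. by apply: continuous_measurable_fun; exact: continuous_sin. Qed.

Section laplace_real.
Context {R : realType}.
Implicit Types (a b : R -> R) (z : plane R) (t : R).

Notation leb := (@lebesgue_measure R).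
Definition halfline : set R := `]0, +oo[.

Lemma measurable_halfline : measurable (halfline : set (measurableTypeR R)).
Proof. exact: measurable_itv. Qed.
Local Hint Resolve measurable_halfline : core.

Lemma halfline_gt0 t : halfline t -> 0 < t.
Proof. by rewrite /halfline/= in_itv/= andbT. Qed.

(** The data whose Laplace transform converges absolutely on the half-plane. *)
Definition admissible a := measurable_fun halfline a /\
  forall x : R, 0 < x -> leb.-integrable halfline (fun t => (expR (- (t * x)) * a t)%:E).

Lemma measurable_expRN (x : R) (D : set R) : measurable_fun D (fun t : R => expR (- (t * x))).
Proof.
apply: measurable_funTS; apply: measurableT_comp => //.
by apply: measurable_funN; apply: measurable_funM.
Qed.

Lemma measurable_cosM (x : R) (D : set R) : measurable_fun D (fun t : R => cos (t * x)).
Proof.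
apply: measurable_funTS; apply: (@measurableT_comp _ _ _ _ _ _ cos); first exact: measurable_cos.
exact: measurable_funM.
Qed.

Lemma measurable_sinM (x : R) (D : set R) : measurable_fun D (fun t : R => sin (t * x)).
Proof.
apply: measurable_funTS; apply: (@measurableT_comp _ _ _ _ _ _ sin); first exact: measurable_sin.
exact: measurable_funM.
Qed.

(** Part of the exponential absorbs the factor [t], by [t * x / 2 <= exp (t *
    x / 2)]. *)
Lemma admissible_id a : admissible a -> admissible (fun t => t * a t).
Proof.
move=> [ma inta]; split; first exact: measurable_funM.
move=> x x0; have x20 : 0 < x / 2 by lra.
have := integrableZl measurable_halfline (2 / x) (inta _ x20).
apply: le_integrable => //.
  apply/measurable_EFinP; apply: measurable_funM; first exact: measurable_expRN.
  exact: measurable_funM.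
move=> t /halfline_gt0 t0; rewrite /= lee_fin !normrM.
rewrite !(ger0_norm (expR_ge0 _)) (gtr0_norm t0).
rewrite (ger0_norm (ler0n _ 2)) (@gtr0_norm _ x^-1) ?invr_gt0//.
rewrite [leLHS]mulrA [leRHS]mulrA ler_wpM2r//.
rewrite (_ : - (t * x) = - (t * (x / 2)) + - (t * (x / 2))); last by field.
rewrite expRD -[leLHS]mulrA [leRHS]mulrC ler_wpM2l ?expR_ge0//.
have tx : t * (x / 2) <= expR (t * (x / 2)).
  by rewrite (le_trans _ (expR_ge1Dx _))// lerDr.
rewrite expRN mulrC ler_pdivrMr ?expR_gt0//.
rewrite -ler_pdivrMl ?divr_gt0// invf_div mulrC.
by rewrite [leLHS]mulrC mulrC.
Qed.

Lemma admissibleZ (c : R) a : admissible a -> admissible (fun t => c * a t).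
Proof.
move=> [ma inta]; split; first exact: measurable_funM.
move=> x x0; have := integrableZl measurable_halfline c (inta x x0).
apply: eq_integrable => // t _; by rewrite /= -EFinM; congr EFin; ring.
Qed.

Lemma admissibleN a : admissible a -> admissible (fun t => - a t).
Proof.
by move/(admissibleZ (-1)); under eq_fun do rewrite mulN1r.
Qed.

(** The integrand of the real part of the Laplace transform of [a + i b] at
    [z]; the imaginary part comes from the pair [(b, - a)]. Working with pairs
    keeps all integrals real. *)
Definition osc a b z t : R :=
  expR (- (t * z.1)) * (a t * cos (t * z.2) + b t * sin (t * z.2)).

Definition osclap a b z : R := \int[leb]_(t in halfline) osc a b z t.

Lemma measurable_osc a b z : admissible a -> admissible b -> measurable_fun halfline (osc a b z).
Proof.
move=> [ma _] [mb _]; apply: measurable_funM; first exact: measurable_expRN.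
apply: measurable_funD; apply: measurable_funM => //.
  exact: measurable_cosM.
exact: measurable_sinM.
Qed.

Lemma norm_osc_le a b z t : `|osc a b z t| <= expR (- (t * z.1)) * (`|a t| + `|b t|).
Proof.
rewrite normrM ger0_norm ?expR_ge0// ler_wpM2l ?expR_ge0//.
rewrite (le_trans (ler_normD _ _))// !normrM lerD//.
  by rewrite -[leRHS]mulr1 ler_wpM2l ?cos_max.
by rewrite -[leRHS]mulr1 ler_wpM2l ?sin_max.
Qed.

Definition expabs a b (x t : R) : R := expR (- (t * x)) * (`|a t| + `|b t|).

Lemma integrable_expabs a b (x : R) : admissible a -> admissible b -> 0 < x ->
  leb.-integrable halfline (EFin \o expabs a b x).
Proof.
move=> [_ ia] [_ ib] x0.
have := integrableD measurable_halfline (integrable_abse (ia x x0)) (integrable_abse (ib x x0)).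
apply: eq_integrable => // t _ /=; rewrite -EFinD; congr EFin.
by rewrite /expabs !normrM (ger0_norm (expR_ge0 _)) mulrDr.
Qed.

Lemma expabs_ge0 a b x t : 0 <= expabs a b x t.
Proof. by rewrite mulr_ge0 ?expR_ge0 ?addr_ge0. Qed.

Lemma integrable_osc a b z : admissible a -> admissible b -> Cplus z ->
  leb.-integrable halfline (EFin \o osc a b z).
Proof.
move=> Aa Ab z0; apply: le_integrable (integrable_expabs Aa Ab z0) => //.
  by apply/measurable_EFinP; exact: measurable_osc.
move=> t _ /=; rewrite lee_fin [leRHS]ger0_norm ?expabs_ge0//; exact: norm_osc_le.
Qed.

Lemma norm_osclap_le a b z : admissible a -> admissible b -> Cplus z ->
  `|osclap a b z| <= \int[leb]_(t in halfline) expabs a b z.1 t.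
Proof.
move=> Aa Ab z0; rewrite (le_trans (le_normr_Rintegral _ (integrable_osc Aa Ab z0)))//.
apply: le_Rintegral => //.
- by have /integrable_abse := integrable_osc Aa Ab z0.
- exact: integrable_expabs.
- by move=> t _; exact: norm_osc_le.
Qed.

(** The partial derivatives of [osclap a b], obtained under the integral sign. *)
Definition osc_dx a b := osclap (fun t => - (t * a t)) (fun t => - (t * b t)).
Definition osc_dy a b := osclap (fun t => t * b t) (fun t => - (t * a t)).

(** With [u = - t h] and [v = t k], the increment factors as [exp (- t x)]
    times a combination of [exp u cos v] and [exp u sin v], to which the
    second-order bounds apply. *)
Lemma osc_taylor a b z (h k : R) t : 0 < t ->
  `|osc a b (z.1 + h, z.2 + k) t - osc a b z t
    - (h * osc (fun t => - (t * a t)) (fun t => - (t * b t)) z t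
       + k * osc (fun t => t * b t) (fun t => - (t * a t)) z t)|
  <= (h ^+ 2 + k ^+ 2) * (3 * (t ^+ 2 * (expR (- (t * z.1)) * expR (t * `|h|) * (`|a t| + `|b t|)))).
Proof.
move=> t0; rewrite /osc /=.
set u := - (t * h); set v := t * k.
(* The pair [(a t, b t)] rotated by the angle [t * z.2]. *)
set A := a t * cos (t * z.2) + b t * sin (t * z.2).
set B := b t * cos (t * z.2) - a t * sin (t * z.2).
rewrite (_ : - (t * (z.1 + h)) = - (t * z.1) + u); last by rewrite /u; ring.
rewrite (_ : t * (z.2 + k) = t * z.2 + v); last by rewrite /v; ring.
rewrite expRD cosD sinD.
rewrite (_ : _ - _ - _ = expR (- (t * z.1)) *
   (A * (expR u * cos v - 1 - u) + B * (expR u * sin v - v))); last first.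
  by rewrite /A /B /u /v; ring.
have uE : `|u| = t * `|h| by rewrite normrN normrM gtr0_norm.
have uv : u ^+ 2 + v ^+ 2 = t ^+ 2 * (h ^+ 2 + k ^+ 2) by rewrite /u /v; ring.
have ab_le (x y c s : R) : `|c| <= 1 -> `|s| <= 1 -> `|x * c + y * s| <= `|x| + `|y|.
  move=> c1 s1; rewrite (le_trans (ler_normD _ _))// !normrM lerD//.
    by rewrite -[leRHS]mulr1 ler_wpM2l.
  by rewrite -[leRHS]mulr1 ler_wpM2l.
have A_le : `|A| <= `|a t| + `|b t| by apply: ab_le; rewrite ?cos_max ?sin_max.
have B_le : `|B| <= `|a t| + `|b t|.
  by rewrite /B -mulNr [leRHS]addrC -(normrN (a t)) ab_le ?cos_max ?sin_max.
rewrite normrM ger0_norm ?expR_ge0//.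
rewrite [leRHS](_ : _ = expR (- (t * z.1)) * ((`|a t| + `|b t|) * ((u ^+ 2 + v ^+ 2) * expR `|u|) +
   (`|a t| + `|b t|) * (2 * (u ^+ 2 + v ^+ 2) * expR `|u|))); last first.
  by rewrite uv uE; ring.
rewrite ler_wpM2l ?expR_ge0// (le_trans (ler_normD _ _))// !normrM.
by rewrite lerD// ler_pM ?norm_expcos_le ?norm_expsin_le.
Qed.

(** Integrating [osc_taylor] costs a factor [t ^+ 2] and half of the
    exponential, hence the restriction on [h]. The quadratic remainder yields
    both the real derivative along horizontal lines and the complex
    derivative. *)
Lemma osclap_taylor a b z : admissible a -> admissible b -> Cplus z ->
  exists2 M : R, 0 < M & forall h k : R, `|h| <= z.1 / 2 ->
    `|osclap a b (z.1 + h, z.2 + k) - osclap a b z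
      - (h * osc_dx a b z + k * osc_dy a b z)| <= M * (h ^+ 2 + k ^+ 2).
Proof.
move=> Aa Ab z0.
have Aa1 := admissible_id Aa; have Ab1 := admissible_id Ab.
have x20 : 0 < z.1 / 2 by rewrite divr_gt0.
have I2 := integrable_expabs (admissible_id Aa1) (admissible_id Ab1) x20.
set J := \int[leb]_(t in halfline) expabs (fun t => t * (t * a t)) (fun t => t * (t * b t)) (z.1 / 2) t.
exists (1 + 3 * J).
  by rewrite ltr_pwDl// mulr_ge0// Rintegral_ge0// => t _; exact: expabs_ge0.
move=> h k hx.
have zhC : Cplus (z.1 + h, z.2 + k).
  rewrite /Cplus/=; move: hx z0; rewrite ler_norml /Cplus/= => /andP[]; lra.
pose D t := osc a b (z.1 + h, z.2 + k) t - osc a b z t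
    - (h * osc (fun t => - (t * a t)) (fun t => - (t * b t)) z t
       + k * osc (fun t => t * b t) (fun t => - (t * a t)) z t).
have i1 := integrable_osc Aa Ab zhC.
have i2 := integrable_osc Aa Ab z0.
have i3 := integrable_osc (admissibleN Aa1) (admissibleN Ab1) z0.
have i4 := integrable_osc Ab1 (admissibleN Aa1) z0.
have i3' : leb.-integrable halfline (EFin \o (fun t => h * osc (fun t => - (t * a t)) (fun t => - (t * b t)) z t)).
  exact: (integrableZl measurable_halfline h i3).
have i4' : leb.-integrable halfline (EFin \o (fun t => k * osc (fun t => t * b t) (fun t => - (t * a t)) z t)).
  exact: (integrableZl measurable_halfline k i4).
have i34 := integrableD measurable_halfline i3' i4'.
have i12 := integrableB measurable_halfline i1 i2.
have iD : leb.-integrable halfline (EFin \o D).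
  exact: (integrableB measurable_halfline i12 i34).
have -> : osclap a b (z.1 + h, z.2 + k) - osclap a b z
      - (h * osc_dx a b z + k * osc_dy a b z) = \int[leb]_(t in halfline) D t.
  rewrite /D /osclap /osc_dx /osc_dy.
  by rewrite RintegralB// RintegralB// RintegralD// RintegralZl// RintegralZl.
rewrite (le_trans (le_normr_Rintegral _ iD))//.
apply: (@le_trans _ _ (\int[leb]_(t in halfline) ((3 * (h ^+ 2 + k ^+ 2)) *
   expabs (fun t => t * (t * a t)) (fun t => t * (t * b t)) (z.1 / 2) t))).
  apply: le_Rintegral => //.
  - by have /integrable_abse := iD.
  - exact: (integrableZl measurable_halfline _ I2).
  - move=> t /halfline_gt0 t0; apply: (le_trans (osc_taylor _ _ _ _ _ t0)).
    rewrite [leRHS](_ : _ = (h ^+ 2 + k ^+ 2) * (3 * (t ^+ 2 * (expR (- (t * (z.1 / 2))) * (`|a t| + `|b t|))))); last first.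
      by rewrite /expabs !normrM (gtr0_norm t0); ring.
    rewrite ler_wpM2l ?addr_ge0 ?sqr_ge0// ler_wpM2l// ler_wpM2l ?sqr_ge0// ler_wpM2r ?addr_ge0//.
    rewrite -expRD ler_expR.
    by have : t * `|h| <= t * (z.1 / 2) by [rewrite ler_wpM2l ?(ltW t0)]; lra.
rewrite RintegralZl// -/J.
rewrite [leRHS](_ : _ = (h ^+ 2 + k ^+ 2) + 3 * (h ^+ 2 + k ^+ 2) * J); last by ring.
by rewrite lerDr addr_ge0 ?sqr_ge0.
Qed.

End laplace_real.

(** * The mean value property on discs *)

Section disc.
Context {R : realType}.
Notation leb := (@lebesgue_measure R).
Implicit Types (z w : plane R).

(** A slice of a disc is empty or an interval at whose endpoints [H] vanishes. *)
Lemma slice_integral0 (H h : R -> R) (c d r : R) :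
  (forall x : R, is_derive x 1 H (h x)) -> continuous h ->
  (forall x, (x - c) ^+ 2 + d ^+ 2 = r ^+ 2 -> H x = 0) ->
  (\int[leb]_(x in [set x : R | ((x - c) ^+ 2 + d ^+ 2 < r ^+ 2)%R]) (h x)%:E = 0)%E.
Proof.
move=> dH ch H0.
have [le0|gt0] := leP (r ^+ 2 - d ^+ 2) 0.
  rewrite (_ : [set x | _] = set0) ?integral_set0//.
  apply/seteqP; split => x //=; have := sqr_ge0 (x - c); lra.
pose b := Num.sqrt (r ^+ 2 - d ^+ 2).
have b0 : 0 < b by rewrite sqrtr_gt0.
have b2 : b ^+ 2 = r ^+ 2 - d ^+ 2 by rewrite sqr_sqrtr// ltW.
rewrite (_ : [set x | _] = `]c - b, c + b[%classic); last first.
  apply/seteqP; split => x /=; rewrite in_itv/=.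
    move=> xr; have : (x - c) ^+ 2 < b ^+ 2 by rewrite b2; lra.
    rewrite -[ltLHS]real_normK ?num_real// ltr_pXn2r// ?nnegrE ?(ltW b0)//.
    by rewrite ltr_norml => /andP[? ?]; apply/andP; split; lra.
  move=> /andP[x1 x2]; have : (x - c) ^+ 2 < b ^+ 2.
    rewrite -[ltLHS]real_normK ?num_real// ltr_pXn2r// ?nnegrE ?(ltW b0)//.
    by rewrite ltr_norml; apply/andP; split; lra.
  by rewrite b2; lra.
have mh : measurable_fun setT h by exact: continuous_measurable_fun.
rewrite integral_itv_obnd_cbnd; last exact/measurable_EFinP/measurable_funTS.
rewrite integral_itv_bndo_bndc; last exact/measurable_EFinP/measurable_funTS.
have cH : continuous H.
  move=> x; apply: differentiable_continuous; apply/derivable1_diffP.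
  exact: ex_derive.
rewrite (@continuous_FTC2 _ h H)//; last 4 first.
- by lra.
- exact: continuous_subspaceT.
- split; [by move=> x _; exact: ex_derive| |].
    exact/cvg_at_right_filter/cH.
  exact/cvg_at_left_filter/cH.
- by move=> x _; rewrite derive1E derive_val.
have -> : H (c + b) = 0 by apply: H0; rewrite (_ : c + b - c = b); [lra|ring].
have -> : H (c - b) = 0 by apply: H0; rewrite (_ : c - b - c = - b); [rewrite sqrrN; lra|ring].
by rewrite subee.
Qed.

Definition disc w (r : R) : set (plane R) :=
  [set z | (z.1 - w.1) ^+ 2 + (z.2 - w.2) ^+ 2 < r ^+ 2].

Lemma measurable_sq w : measurable_fun setT
  (fun z : plane R => (z.1 - w.1) ^+ 2 + (z.2 - w.2) ^+ 2 : R).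
Proof.
apply: measurable_funD; apply: measurable_funX; apply: measurable_funB => //.
Qed.

Lemma measurable_disc w r : measurable (disc w r).
Proof.
rewrite (_ : disc w r = setT `&` (fun z : plane R => (z.1 - w.1) ^+ 2 + (z.2 - w.2) ^+ 2 : R) @^-1`
  `]-oo, r ^+ 2[%classic); first exact: (measurable_sq w).
by apply/seteqP; split => z; rewrite /disc/= in_itv/= => // -[].
Qed.

Definition box w (r : R) : set (plane R) := `[w.1 - r, w.1 + r] `*` `[w.2 - r, w.2 + r].

Lemma area_box w r : 0 < r -> area R (box w r) = ((2 * r) ^+ 2)%:E.
Proof.
move=> r0.
have -> : area R (box w r) = (leb `[(w.1 - r)%R, (w.1 + r)%R]%classic * leb `[(w.2 - r)%R, (w.2 + r)%R]%classic)%E.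
  by apply: product_measure1E; exact: measurable_itv.
rewrite !lebesgue_measure_itv/= !lte_fin !ifT; [|lra..].
by rewrite -!EFinB -EFinM; congr EFin; ring.
Qed.

Lemma measurable_box w r : measurable (box w r).
Proof. by apply: measurableX; exact: measurable_itv. Qed.

Lemma disc_coord w r z : 0 < r -> disc w r z -> `|z.1 - w.1| <= r /\ `|z.2 - w.2| <= r.
Proof.
move=> r0 D; have s1 := sqr_ge0 (z.1 - w.1); have s2 := sqr_ge0 (z.2 - w.2).
split; rewrite -(@ler_pXn2r _ 2)// ?nnegrE ?(ltW r0)// real_normK ?num_real//.
  by move: D; rewrite /disc/=; lra.
by move: D; rewrite /disc/=; lra.
Qed.

Lemma disc_box w r : 0 < r -> disc w r `<=` box w r.
Proof.
move=> r0 z /(disc_coord r0); rewrite !ler_norml => -[/andP[? ?] /andP[? ?]].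
by split; rewrite /= in_itv/=; apply/andP; split; lra.
Qed.

Lemma box_disc w r : 0 < r -> box w (r / 2) `<=` disc w r.
Proof.
move=> r0 z [/=]; rewrite !in_itv/= => /andP[? ?] /andP[? ?]; rewrite /disc/=.
have sq (x : R) : - (r / 2) <= x -> x <= r / 2 -> x ^+ 2 <= (r / 2) ^+ 2.
  by move=> x1 x2; rewrite -[leLHS]real_normK ?num_real// lerXn2r ?nnegrE ?divr_ge0 ?(ltW r0)// ler_norml x1.
have b1 : (z.1 - w.1) ^+ 2 <= (r / 2) ^+ 2 by apply: sq; lra.
have b2 : (z.2 - w.2) ^+ 2 <= (r / 2) ^+ 2 by apply: sq; lra.
have : 0 < r ^+ 2 by rewrite exprn_gt0.
by move: b1 b2; rewrite expr_div_n; lra.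
Qed.

Lemma area_disc_lty w r : 0 < r -> (area R (disc w r) < +oo)%E.
Proof.
move=> r0; apply: (@le_lt_trans _ _ (area R (box w r))); last by rewrite area_box// ltry.
by apply: le_measure; rewrite ?inE; [exact: measurable_disc|exact: measurable_box|exact: disc_box].
Qed.

Lemma area_disc_ge w r : 0 < r -> ((r ^+ 2)%:E <= area R (disc w r))%E.
Proof.
move=> r0; rewrite (_ : r ^+ 2 = (2 * (r / 2)) ^+ 2); last by field.
rewrite -(@area_box w); last by rewrite divr_gt0.
by apply: le_measure; rewrite ?inE; [exact: measurable_box|exact: measurable_disc|exact: box_disc].
Qed.

Lemma integrable_disc w r (g : plane R -> R) (M : R) : 0 < r ->
  measurable_fun setT g -> (forall z, disc w r z -> `|g z| <= M) ->
  (area R).-integrable (disc w r) (EFin \o g).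
Proof.
move=> r0 mg gM; apply: measurable_bounded_integrable.
- exact: measurable_disc.
- exact: area_disc_lty.
- exact: measurable_funTS.
- exists M; split; rewrite ?num_real// => x Mx z Dz; exact: le_trans (gM _ Dz) (ltW Mx).
Qed.

(** The divergence theorem for a field along the first axis that vanishes on
    the circle: integrate along horizontal slices first. *)
Lemma disc_integral_dx w r (H h : plane R -> R) :
  (forall x y : R, is_derive x 1 (fun x => H (x, y)) (h (x, y))) ->
  (forall y : R, continuous (fun x => h (x, y))) ->
  (forall z, (z.1 - w.1) ^+ 2 + (z.2 - w.2) ^+ 2 = r ^+ 2 -> H z = 0) ->
  (area R).-integrable (disc w r) (EFin \o h) ->
  (\int[area R]_(z in disc w r) (h z)%:E = 0)%E.
Proof.
move=> dH ch H0 ih.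
have mD := measurable_disc w r.
rewrite integral_mkcond.
rewrite -(integral21_prod_meas1 (m1 := leb) (m2 := leb)); last first.
  by apply/(integrable_mkcond _ mD).
apply: integral0_eq => y _; rewrite /fubini_G.
rewrite -[RHS](@slice_integral0 (fun x => H (x, y)) (fun x => h (x, y)) w.1 (y - w.2) r)//; last first.
  by move=> x xE; exact: H0.
rewrite [RHS]integral_mkcond; apply: eq_integral => x _.
by rewrite !patchE; congr (if _ then _ else _); apply/idP/idP => /set_mem ?; apply/mem_set.
Qed.

Lemma disc_integral_dy w r (H h : plane R -> R) :
  (forall x y : R, is_derive y 1 (fun y => H (x, y)) (h (x, y))) ->
  (forall x : R, continuous (fun y => h (x, y))) ->
  (forall z, (z.1 - w.1) ^+ 2 + (z.2 - w.2) ^+ 2 = r ^+ 2 -> H z = 0) ->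
  (area R).-integrable (disc w r) (EFin \o h) ->
  (\int[area R]_(z in disc w r) (h z)%:E = 0)%E.
Proof.
move=> dH ch H0 ih.
have mD := measurable_disc w r.
rewrite integral_mkcond.
rewrite -(integral12_prod_meas1 (m1 := leb) (m2 := leb)); last first.
  by apply/(integrable_mkcond _ mD).
apply: integral0_eq => x _; rewrite /fubini_F.
rewrite -[RHS](@slice_integral0 (fun y => H (x, y)) (fun y => h (x, y)) w.2 (x - w.1) r)//; last first.
  by move=> y yE; apply: H0; rewrite /= addrC.
rewrite [RHS]integral_mkcond; apply: eq_integral => y _.
by rewrite !patchE; congr (if _ then _ else _); apply/idP/idP => /set_mem ?; apply/mem_set;
  rewrite /disc/= addrC.
Qed.

End disc.

Section exp_derive.
Context {R : realType}.
Implicit Types t c x k : R.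

Lemma is_derive_affine t c x : is_derive x 1 (fun x : R => t * (x - c)) t.
Proof.
have D : is_derive x (1 : R) (t \*: (fun x : R => x - c)) (t *: (1 - 0)).
  by apply: is_deriveZ.
by apply: is_derive_eq D _; rewrite subr0 /GRing.scale/= mulr1.
Qed.

Lemma is_derive_expN t c x :
  is_derive x 1 (fun x : R => expR (- (t * (x - c)))) (- t * expR (- (t * (x - c)))).
Proof.
have D := is_deriveN (is_derive_affine t c x).
by apply: is_derive_eq (is_derive1_comp (is_derive_expR _) D) _; rewrite mulrC.
Qed.

Lemma is_derive_cosM t c x :
  is_derive x 1 (fun x : R => cos (t * (x - c))) (- (t * sin (t * (x - c)))).
Proof.
apply: is_derive_eq (is_derive1_comp (is_derive_cos _) (is_derive_affine t c x)) _.
by ring.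
Qed.

Lemma is_derive_sinM t c x :
  is_derive x 1 (fun x : R => sin (t * (x - c))) (t * cos (t * (x - c))).
Proof.
apply: is_derive_eq (is_derive1_comp (is_derive_sin _) (is_derive_affine t c x)) _.
by ring.
Qed.

Lemma is_derive_sqD c k x :
  is_derive x 1 (fun x : R => (x - c) ^+ 2 + k) (2 * (x - c)).
Proof.
have D : is_derive x (1 : R) ((fun x : R => x - c) ^+ 2 + cst k)
    ((2 * (x - c) ^+ 1) *: (1 - 0) + 0).
  apply: is_deriveD; exact: is_deriveX.
by apply: is_derive_eq D _; rewrite /GRing.scale/=; ring.
Qed.

Lemma is_deriveMr (f g : R -> R) (df dg x : R) : is_derive x 1 f df -> is_derive x 1 g dg ->
  is_derive x 1 (fun x => f x * g x) (df * g x + f x * dg).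
Proof.
move=> Df Dg; apply: is_derive_eq (is_deriveM Df Dg) _.
by rewrite /GRing.scale/=; ring.
Qed.

End exp_derive.

Section exp_mean.
Context {R : realType}.
Notation leb := (@lebesgue_measure R).
Implicit Types (z w : plane R).

Lemma derivable_continuous (f : R -> R) (df : R -> R) :
  (forall x : R, is_derive x 1 f (df x)) -> continuous f.
Proof.
move=> fD x; apply: differentiable_continuous; apply/derivable1_diffP.
exact: ex_derive.
Qed.

Lemma continuous_mulf (f g : R -> R) : continuous f -> continuous g ->
  continuous (fun x => f x * g x).
Proof. by move=> cf cg x; apply: cvgM; [exact: cf|exact: cg]. Qed.

Lemma continuous_addf (f g : R -> R) : continuous f -> continuous g ->
  continuous (fun x => f x + g x).
Proof. by move=> cf cg x; apply: cvgD; [exact: cf|exact: cg]. Qed.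

Variables (w : plane R) (r t : R).
Hypothesis r0 : 0 < r.

Let p z : R := z.1 - w.1.
Let q z : R := z.2 - w.2.
Let psi z : R := (z.1 - w.1) ^+ 2 + (z.2 - w.2) ^+ 2 - r ^+ 2.
Let e z : R := expR (- (t * (z.1 - w.1))).

Let mp : measurable_fun setT p.
Proof. by apply: measurable_funB. Qed.

Let mq : measurable_fun setT q.
Proof. by apply: measurable_funB. Qed.

Let mpsi : measurable_fun setT psi.
Proof. by apply: measurable_funB => //; exact: measurable_sq. Qed.

Let me : measurable_fun setT e.
Proof.
apply: measurableT_comp => //; apply: measurable_funN; apply: measurable_funM => //.
Qed.

Let p_le z : disc w r z -> `|p z| <= r.
Proof. by case/(disc_coord r0). Qed.

Let q_le z : disc w r z -> `|q z| <= r.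
Proof. by case/(disc_coord r0). Qed.

Let psi_le z : disc w r z -> `|psi z| <= r ^+ 2.
Proof.
rewrite /disc/= => D; rewrite ler_norml /psi.
have := sqr_ge0 (z.1 - w.1); have := sqr_ge0 (z.2 - w.2) => ? ?.
by apply/andP; split; lra.
Qed.

Let e_le z : disc w r z -> `|e z| <= expR (`|t| * r).
Proof.
move=> /p_le pr; rewrite ger0_norm ?expR_ge0// ler_expR.
by rewrite (le_trans (ler_norm _))// normrN normrM ler_wpM2l.
Qed.

Let M : R := (2 * r + `|t| * r ^+ 2) * expR (`|t| * r).

(** The function integrated is the [x]-derivative of [psi * e * g], where
    [psi] vanishes on the circle. *)
Lemma disc_integral_dx_exp (K : R) (g : R -> R) :
  measurable_fun setT g -> (forall y, `|g y| <= K) ->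
  let h := fun z : plane R => (2 * p z - t * psi z) * e z * g z.2 in
  (area R).-integrable (disc w r) (EFin \o h) /\
  (\int[area R]_(z in disc w r) (h z)%:E = 0)%E.
Proof.
move=> mg g1 h.
have ih : (area R).-integrable (disc w r) (EFin \o h).
  apply: (@integrable_disc _ _ _ _ (M * K)) => //.
    apply: measurable_funM; last by apply: measurableT_comp.
    by apply: measurable_funM => //; apply: measurable_funB; apply: measurable_funM.
  move=> z Dz; rewrite normrM ler_pM// normrM ler_pM ?e_le//.
  rewrite (le_trans (ler_normB _ _))// !normrM (ger0_norm (ler0n _ 2)).
  by rewrite lerD// ler_wpM2l ?p_le ?psi_le.
split => //; apply: (disc_integral_dx (H := fun z => psi z * e z * g z.2)) ih.
- move=> x y; have D1 := is_derive_sqD w.1 ((y - w.2) ^+ 2 - r ^+ 2) x.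
  have D2 := is_derive_expN t w.1 x.
  have D := is_deriveMr (is_deriveMr D1 D2) (is_derive_cst (g y) x 1).
  rewrite (_ : (fun x => _) = (fun x => ((x - w.1) ^+ 2 + ((y - w.2) ^+ 2 - r ^+ 2)) *
     expR (- (t * (x - w.1))) * cst (g y) x)); last first.
    by apply/funext => u; rewrite /psi/= addrA.
  by apply: is_derive_eq D _; rewrite /h /psi /p /e/=; ring.
- move=> y.
  have ca := derivable_continuous (is_derive_affine 2 w.1).
  have cpsi := derivable_continuous (is_derive_sqD w.1 ((y - w.2) ^+ 2 - r ^+ 2)).
  have ce := derivable_continuous (is_derive_expN t w.1).
  have cc (k : R) : continuous (fun _ : R => k) by move=> x; exact: cvg_cst.
  have C := continuous_mulf (continuous_mulf
    (continuous_addf ca (continuous_mulf (cc (- t)) cpsi)) ce) (cc (g y)).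
  by move: C; congr (continuous _); apply/funext => x; apply/funext => u; rewrite /h /psi /p /e/=; ring.
- by move=> z zE; rewrite /psi zE subrr !mul0r.
Qed.

(** The function integrated is the [y]-derivative of [psi * g * e]. *)
Lemma disc_integral_dy_exp (K : R) (g dg : R -> R) :
  measurable_fun setT g -> (forall y, `|g y| <= K) ->
  continuous dg -> (forall y, `|dg y| <= `|t| * K) ->
  (forall y : R, is_derive y 1 g (dg y)) ->
  let h := fun z : plane R => (2 * q z * g z.2 + psi z * dg z.2) * e z in
  (area R).-integrable (disc w r) (EFin \o h) /\
  (\int[area R]_(z in disc w r) (h z)%:E = 0)%E.
Proof.
move=> mg g1 cdg dgt gD h.
have mdg : measurable_fun setT dg by exact: continuous_measurable_fun.
have ih : (area R).-integrable (disc w r) (EFin \o h).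
  apply: (@integrable_disc _ _ _ _ (M * K)) => //.
    apply: measurable_funM => //; apply: measurable_funD; apply: measurable_funM.
    - exact: measurable_funM.
    - exact: measurableT_comp.
    - exact: mpsi.
    - exact: measurableT_comp.
  move=> z Dz; rewrite /M [leRHS]mulrAC normrM ler_pM ?e_le//.
  rewrite (le_trans (ler_normD _ _))// !normrM (ger0_norm (ler0n _ 2)) [leRHS]mulrDl.
  rewrite lerD//; first by rewrite ler_pM// ler_wpM2l ?q_le.
  by rewrite mulrAC mulrC ler_pM ?psi_le.
split => //; apply: (disc_integral_dy (H := fun z => psi z * g z.2 * e z)) ih.
- move=> x y; have D1 := is_derive_sqD w.2 ((x - w.1) ^+ 2 - r ^+ 2) y.
  have D := is_deriveMr (is_deriveMr D1 (gD y)) (is_derive_cst (e (x, 0)) y 1).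
  rewrite (_ : (fun y => _) = (fun y => ((y - w.2) ^+ 2 + ((x - w.1) ^+ 2 - r ^+ 2)) *
     g y * cst (e (x, 0)) y)); last first.
    by apply/funext => u; rewrite /psi/= addrCA addrA.
  by apply: is_derive_eq D _; rewrite /h /psi /q /e/=; ring.
- move=> x.
  have ca := derivable_continuous (is_derive_affine 2 w.2).
  have cpsi := derivable_continuous (is_derive_sqD w.2 ((x - w.1) ^+ 2 - r ^+ 2)).
  have cg := derivable_continuous gD.
  have cc (k : R) : continuous (fun _ : R => k) by move=> y; exact: cvg_cst.
  have C := continuous_mulf (continuous_addf (continuous_mulf ca cg)
    (continuous_mulf cpsi cdg)) (cc (e (x, 0))).
  by move: C; congr (continuous _); apply/funext => y; apply/funext => u; rewrite /h /psi /q /e/=; ring.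
- by move=> z zE; rewrite /psi zE subrr !mul0r.
Qed.

(** For holomorphic [E], the function [zeta * E] is the derivative of [psi *
    E] in the conjugate variable, as [psi + r ^+ 2] is the squared modulus of
    [zeta]; so its integral over the disc vanishes. This is the case where [E]
    is an exponential, in real form; the minus sign matches the derivative of
    the exponential in [t]. *)
Lemma disc_integral_radial_exp (K : R) (g gc : R -> R) :
  continuous g -> (forall y, `|g y| <= K) -> (forall y, `|gc y| <= K) ->
  (forall y : R, is_derive y 1 gc (t * g y)) ->
  \int[area R]_(z in disc w r) (- ((p z * g z.2 + q z * gc z.2) * e z)) = 0.
Proof.
move=> cg gK gcK gcD.
have mg : measurable_fun setT g by exact: continuous_measurable_fun.
have mgc : measurable_fun setT gc.
  exact: (continuous_measurable_fun (derivable_continuous gcD)).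
have ctg : continuous (fun y => t * g y).
  by apply: continuous_mulf => // y; exact: cvg_cst.
have tgK y : `|t * g y| <= `|t| * K by rewrite normrM ler_wpM2l.
have [i1 h1] := disc_integral_dx_exp mg gK.
have [i2 h2] := disc_integral_dy_exp mgc gcK ctg tgK gcD.
have mD := measurable_disc w r.
(* The terms in [t * psi] of the two derivatives cancel. *)
pose h z := (2 * p z - t * psi z) * e z * g z.2 +
  (2 * q z * gc z.2 + psi z * (t * g z.2)) * e z.
rewrite (_ : (fun z => _) = (fun z => (- 2^-1) * h z)); last first.
  by apply/funext => z; rewrite /h; field.
have ih : (area R).-integrable (disc w r) (EFin \o h).
  exact: (integrableD mD i1 i2).
rewrite RintegralZl// RintegralD// {1}/Rintegral h1 {1}/Rintegral h2.
by rewrite addr0 mulr0.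
Qed.

End exp_mean.

Section disc_mean.
Context {R : realType}.
Variables (w : plane R) (r : R).
Hypothesis r0 : 0 < r.
Notation leb := (@lebesgue_measure R).
Variables A B : R.

Let G (t : R) (z : plane R) : R := expR (- (t * (z.1 - w.1))) *
  (A * cos (t * (z.2 - w.2)) + B * sin (t * (z.2 - w.2))).
Let DG (t : R) (z : plane R) : R := - (((z.1 - w.1) * (A * cos (t * (z.2 - w.2)) + B * sin (t * (z.2 - w.2)))
   + (z.2 - w.2) * (A * sin (t * (z.2 - w.2)) - B * cos (t * (z.2 - w.2)))) * expR (- (t * (z.1 - w.1)))).
Let K : R := `|A| + `|B|.

Let G_derive (t : R) (z : plane R) : is_derive t 1 (fun t => G t z) (DG t z).
Proof.
have lin c : (fun t : R => t * c) = (fun t : R => c * (t - 0)).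
  by apply/funext => u; rewrite subr0 mulrC.
have D1 := is_derive_expN (z.1 - w.1) 0 t.
have D2 := is_deriveMr (is_derive_cst A t 1) (is_derive_cosM (z.2 - w.2) 0 t).
have D3 := is_deriveMr (is_derive_cst B t 1) (is_derive_sinM (z.2 - w.2) 0 t).
have D := is_deriveMr D1 (is_deriveD D2 D3).
rewrite (_ : (fun t => G t z) = (fun u => expR (- ((z.1 - w.1) * (u - 0))) *
  (cst A u * cos ((z.2 - w.2) * (u - 0)) + cst B u * sin ((z.2 - w.2) * (u - 0))))).
  by apply: is_derive_eq D _; rewrite /DG/= !fctE !subr0 ![(_ - _) * t]mulrC; ring.
by apply/funext => u; rewrite /G subr0 ![(_ - _) * u]mulrC.
Qed.

Let trig_le (a b x : R) : `|a * cos x + b * sin x| <= `|a| + `|b|.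
Proof.
rewrite (le_trans (ler_normD _ _))// !normrM.
by rewrite lerD// -[leRHS]mulr1 ler_wpM2l ?cos_max ?sin_max.
Qed.

Let trig_le' (a b x : R) : `|a * sin x - b * cos x| <= `|a| + `|b|.
Proof. by rewrite addrC -mulNr (le_trans (trig_le _ _ _))// normrN addrC. Qed.

Let measurable_G t : measurable_fun setT (G t).
Proof.
apply: measurable_funM.
  apply: measurableT_comp => //; apply: measurable_funN; apply: measurable_funM => //.
  exact: measurable_funB.
apply: measurable_funD; apply: measurable_funM => //.
  apply: (@measurableT_comp _ _ _ _ _ _ cos); first exact: measurable_cos.
  by apply: measurable_funM => //; exact: measurable_funB.
apply: (@measurableT_comp _ _ _ _ _ _ sin); first exact: measurable_sin.
by apply: measurable_funM => //; exact: measurable_funB.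
Qed.

Let exp_le t z : disc w r z -> expR (- (t * (z.1 - w.1))) <= expR (`|t| * r).
Proof.
move=> /(disc_coord r0)[pr _]; rewrite ler_expR.
by rewrite (le_trans (ler_norm _))// normrN normrM ler_wpM2l.
Qed.

Lemma integrable_disc_G t : (area R).-integrable (disc w r) (EFin \o G t).
Proof.
apply: (@integrable_disc _ _ _ _ (expR (`|t| * r) * K)) => // z Dz.
by rewrite normrM ler_pM// ger0_norm ?expR_ge0 ?exp_le.
Qed.

Let DG_integral t : \int[area R]_(z in disc w r) DG t z = 0.
Proof.
pose g (y : R) := A * cos (t * (y - w.2)) + B * sin (t * (y - w.2)).
pose gc (y : R) := A * sin (t * (y - w.2)) - B * cos (t * (y - w.2)).
have gD (y : R) : is_derive y 1 g (- (t * gc y)).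
  have D := is_deriveD (is_deriveMr (is_derive_cst A y 1) (is_derive_cosM t w.2 y))
    (is_deriveMr (is_derive_cst B y 1) (is_derive_sinM t w.2 y)).
  by apply: is_derive_eq D _; rewrite /gc /cst; ring.
have gcD (y : R) : is_derive y 1 gc (t * g y).
  have D := is_deriveB (is_deriveMr (is_derive_cst A y 1) (is_derive_sinM t w.2 y))
    (is_deriveMr (is_derive_cst B y 1) (is_derive_cosM t w.2 y)).
  by apply: is_derive_eq D _; rewrite /g /cst; ring.
exact: (@disc_integral_radial_exp R w r t r0 K g gc (derivable_continuous gD)
  (fun y => trig_le _ _ _) (fun y => trig_le' _ _ _) gcD).
Qed.

(** The derivative in [t] of the integral is the vanishing radial integral, so
    the integral keeps its value at [t = 0]. *)
Lemma disc_mean_exp t : \int[area R]_(z in disc w r) G t z = A * fine (area R (disc w r)).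
Proof.
have mD := measurable_disc w r.
have d1E u z : partial1of2 G u z = DG u z.
  by rewrite partial1of2E; have := G_derive u z => D; rewrite derive_val.
have FD (u : R) : is_derive u 1 (fun u => \int[area R]_(z in disc w r) G u z) 0.
  (* Differentiation under the integral sign, on an interval around [u]. *)
  pose T := `|u| + 1.
  have uI : `]-T, T[%classic u.
    by rewrite /= in_itv/= -ltr_norml /T ltrDl.
  pose M : R := (2 * r * K) * expR (T * r).
  have M0 : 0 <= M by rewrite !mulr_ge0 ?addr_ge0 ?expR_ge0// ltW.
  have iM : (area R).-integrable (disc w r) (EFin \o (fun _ : plane R => M)).
    by apply: (@integrable_disc _ _ _ _ M) => // z _; rewrite ger0_norm.
  have dG x z : `]-T, T[%classic x -> disc w r z -> derivable (G ^~ z) x 1.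
    by move=> _ _; have D := G_derive x z; exact: ex_derive.
  have bG x z : `]-T, T[%classic x -> disc w r z -> `|partial1of2 G x z| <= M.
    rewrite /= in_itv/= -ltr_norml d1E => xT Dz; have [pr qr] := disc_coord r0 Dz.
    rewrite /DG normrN normrM ler_pM//; last first.
      rewrite ger0_norm ?expR_ge0// (le_trans (exp_le _ Dz))// ler_expR.
      by rewrite ler_wpM2r ?(ltW r0)// ltW.
    rewrite [leRHS](_ : _ = r * K + r * K); last by ring.
    rewrite (le_trans (ler_normD _ _))// !normrM lerD//.
      by apply: ler_pM => //; exact: trig_le.
    by apply: ler_pM => //; exact: trig_le'.
  have iG x (xI : `]-T, T[%classic x) := integrable_disc_G x.
  have dF := derivable_under_integral mD uI iG dG (fun _ => M0) iM bG.
  have eF := differentiation_under_integral mD uI iG dG (fun _ => M0) iM bG.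
  apply: DeriveDef => //; rewrite -derive1E eF.
  by under eq_Rintegral do rewrite d1E; exact: DG_integral.
rewrite (is_derive_0_is_cst t 0 FD).
rewrite (_ : G 0 = cst A); last first.
  by apply/funext => z; rewrite /G !mul0r oppr0 expR0 cos0 sin0 mul1r mulr1 mulr0 addr0.
by rewrite Rintegral_cst.
Qed.

End disc_mean.

Section sigma_finite_area.
Context {R : realType}.
Notation leb := (@lebesgue_measure R).

(** The area measure under a name of its own, to carry the sigma-finiteness
    that the Fubini theorem requires. *)
Definition sf_area : set (plane R) -> \bar R := area R.

HB.instance Definition _ := Measure.on sf_area.

Let sigma_finite_area : sigma_finite setT sf_area.
Proof.
have /sigma_finiteP[F [TF ndF Foo]] := @sigma_finiteT _ _ R leb.
exists (fun n => F n `*` F n).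
  rewrite -setXTT TF predeqE => -[x y]; split.
    move=> [/= [n _ Fnx] [k _ Gky]]; exists (maxn n k) => //; split.
    - by move: x Fnx; exact/subsetPset/ndF/leq_maxl.
    - by move: y Gky; exact/subsetPset/ndF/leq_maxr.
  by move=> [n _ []/= ? ?]; split; exists n.
move=> k; have [? ?] := Foo k.
split; first exact: measurableX.
have -> : (sf_area (F k `*` F k) = leb (F k) * leb (F k))%E by apply: product_measure1E.
by rewrite lte_mul_pinfty// ge0_fin_numE.
Qed.

HB.instance Definition _ :=
  Measure_isSigmaFinite.Build _ _ _ sf_area sigma_finite_area.

End sigma_finite_area.

Section osclap_mean.
Context {R : realType}.
Notation leb := (@lebesgue_measure R).
Let leb2 : {sigma_finite_measure set (plane R) -> \bar R} := @sf_area R.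
Variables a b : R -> R.
Hypotheses (Aa : admissible a) (Ab : admissible b).

Let a0 : R -> R := a \_ halfline.
Let b0 : R -> R := b \_ halfline.

Let ma0 : measurable_fun setT a0.
Proof.
by apply: (measurable_restrictT _ _).1; [exact: measurable_halfline|case: Aa].
Qed.

Let mb0 : measurable_fun setT b0.
Proof.
by apply: (measurable_restrictT _ _).1; [exact: measurable_halfline|case: Ab].
Qed.

Let J (zt : plane R * measurableTypeR R) : R := osc a0 b0 zt.1 zt.2.

Let J_restrict z t : J (z, t) = (osc a b z \_ halfline) t.
Proof.
rewrite /J /osc /a0 /b0 !patchE/=; case: ifP => // _.
by rewrite !mul0r addr0 mulr0.
Qed.

Let measurable_J : measurable_fun setT J.
Proof.
have m1 : measurable_fun setT (fun zt : plane R * measurableTypeR R => zt.1.1 : R).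
  by apply: (measurableT_comp measurable_fst).
have m2 : measurable_fun setT (fun zt : plane R * measurableTypeR R => zt.1.2 : R).
  by apply: (measurableT_comp measurable_snd).
have mt : measurable_fun setT (fun zt : plane R * measurableTypeR R => zt.2 : R).
  exact: measurable_snd.
apply: measurable_funM.
  apply: measurableT_comp => //; apply: measurable_funN; exact: measurable_funM.
apply: measurable_funD; apply: measurable_funM.
- exact: (measurableT_comp ma0).
- apply: (@measurableT_comp _ _ _ _ _ _ cos); first exact: measurable_cos.
  exact: measurable_funM.
- exact: (measurableT_comp mb0).
- apply: (@measurableT_comp _ _ _ _ _ _ sin); first exact: measurable_sin.
  exact: measurable_funM.
Qed.

Let osclapE z : osclap a b z = fine (\int[leb]_t (J (z, t))%:E).
Proof.
rewrite /osclap /Rintegral integral_mkcond; congr fine.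
by apply: eq_integral => t _; rewrite J_restrict restrict_EFin.
Qed.

(** The integral over [t] of a jointly measurable function, split into
    positive and negative parts. *)
Lemma measurable_osclap : measurable_fun setT (osclap a b : plane R -> R).
Proof.
have mJ : measurable_fun setT (EFin \o J) by exact/measurable_EFinP.
have mp := @measurable_fun_fubini_tonelli_F _ _ _ _ R leb _ (measurable_funepos mJ) (fun=> funepos_ge0 _ _).
have mn := @measurable_fun_fubini_tonelli_F _ _ _ _ R leb _ (measurable_funeneg mJ) (fun=> funeneg_ge0 _ _).
rewrite (_ : osclap a b = fine \o (fun z => fubini_F leb (EFin \o J)^\+ z - fubini_F leb (EFin \o J)^\- z)%E).
  apply: measurableT_comp; first exact: fine_measurable.
  exact: emeasurable_funB.
apply/funext => z; rewrite osclapE; congr fine.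
rewrite integralE /fubini_F; congr (_ - _)%E; apply: eq_integral => t _.
  by rewrite !funeposE.
by rewrite !funenegE.
Qed.

Variables (w : plane R) (r : R).
Hypotheses (r0 : 0 < r) (rw : r < w.1).

Lemma disc_Cplus : disc w r `<=` @Cplus R.
Proof.
move=> z /(disc_coord r0)[+ _]; rewrite ler_norml /Cplus/= => /andP[? _].
by move: rw; lra.
Qed.

Let f (zt : plane R * measurableTypeR R) : \bar R := (\1_(disc w r) zt.1 * J zt)%:E.

Let mf : measurable_fun setT f.
Proof.
apply/measurable_EFinP; apply: measurable_funM => //.
have mi : measurable_fun setT (\1_(disc w r) : plane R -> R).
  by apply: measurable_indic; exact: measurable_disc.
exact: (measurableT_comp mi measurable_fst).
Qed.

Let x0 : R := w.1 - r.

Let inner_abs z : (\int[leb]_t `|f (z, t)| <=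
  (\1_(disc w r) z)%:E * \int[leb]_(t in halfline) (expabs a b x0 t)%:E)%E.
Proof.
have [Dz|nDz] := pselect (disc w r z); last first.
  rewrite indicE memNset// mul0e integral0_eq// => t _.
  by rewrite /f /= indicE memNset// mul0r normr0.
rewrite indicE mem_set// mul1e [leRHS]integral_mkcond.
apply: ge0_le_integral_any => // t _.
rewrite /f/= indicE mem_set// mul1r J_restrict !patchE.
case: ifPn => [/set_mem/halfline_gt0 t0|_]; last by rewrite normr0.
rewrite lee_fin (le_trans (norm_osc_le _ _ _ _))// ler_wpM2r ?addr_ge0// ler_expR lerN2.
rewrite ler_wpM2l ?(ltW t0)//.
by have [] := disc_coord r0 Dz; rewrite ler_norml /x0 => /andP[? _] _; lra.
Qed.

Let intf : (leb2 \x leb)%E.-integrable setT f.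
Proof.
apply/integrable12ltyP => //.
have le_f : (\int[leb2]_z \int[leb]_t `|f (z, t)| <=
    \int[leb2]_z ((\1_(disc w r) z)%:E * \int[leb]_(t in halfline) (expabs a b x0 t)%:E))%E.
  apply: ge0_le_integral_any => z _; last exact: inner_abs.
  exact: integral_ge0.
apply: (le_lt_trans le_f).
have E0 : (0 <= \int[leb]_(t in halfline) (expabs a b x0 t)%:E)%E.
  by apply: integral_ge0 => t _; rewrite lee_fin expabs_ge0.
have Efin : (\int[leb]_(t in halfline) (expabs a b x0 t)%:E)%E \is a fin_num.
  apply: integrable_fin_num; first exact: measurable_halfline.
  apply: integrable_expabs => //; rewrite /x0 subr_gt0//.
have mD := measurable_disc w r.
rewrite ge0_integralZr//; last first.
  by apply/measurable_EFinP; exact: measurable_indic.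
rewrite integral_indic// setIT lte_mul_pinfty//.
  by rewrite ge0_fin_numE//; exact: (area_disc_lty w r0).
by rewrite ltey_eq Efin.
Qed.

Let osc_disc t : halfline t ->
  (\int[leb2]_(z in disc w r) (osc a b z t)%:E =
   (osc a b w t * fine (area R (disc w r)))%:E)%E.
Proof.
move=> _.
(* Recentring at [w] rotates the pair [(a t, b t)] by the angle [t * w.2]. *)
pose A := a t * cos (t * w.2) + b t * sin (t * w.2).
pose B := b t * cos (t * w.2) - a t * sin (t * w.2).
pose G z := expR (- (t * (z.1 - w.1))) *
  (A * cos (t * (z.2 - w.2)) + B * sin (t * (z.2 - w.2))).
have GE z : osc a b z t = expR (- (t * w.1)) * G z.
  rewrite /osc /G /A /B.
  rewrite (_ : - (t * z.1) = - (t * w.1) + - (t * (z.1 - w.1))); last by ring.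
  rewrite (_ : t * z.2 = t * w.2 + t * (z.2 - w.2)); last by ring.
  by rewrite expRD cosD sinD; ring.
have mD := measurable_disc w r.
have iG := @integrable_disc_G R w r r0 A B t.
under eq_integral do rewrite GE EFinM.
rewrite integralZl//.
have E : (\int[leb2]_(z in disc w r) (G z)%:E = (A * fine (area R (disc w r)))%:E)%E.
  rewrite -(fineK (integrable_fin_num mD iG)); congr EFin.
  exact: (@disc_mean_exp R w r r0 A B t).
by rewrite E -EFinM mulrA.
Qed.

(** By Fubini, the mean over the disc can be taken inside the Laplace
    integral, where [disc_mean_exp] applies at each [t]. *)
Lemma osclap_disc_mean :
  \int[area R]_(z in disc w r) osclap a b z = osclap a b w * fine (area R (disc w r)).
Proof.
have wC : Cplus w by rewrite /Cplus/= (lt_trans r0).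
have FE := Fubini intf.
have hL : (\int[leb2]_z \int[leb]_t f (z, t) = \int[leb2]_(z in disc w r) (osclap a b z)%:E)%E.
  rewrite [RHS]integral_mkcond; apply: eq_integral => z _.
  rewrite patchE; case: ifPn => [zD|znD]; last first.
    by apply: integral0_eq => t _; rewrite /f/= indicE (negbTE znD) mul0r.
  rewrite osclapE fineK; last first.
    rewrite (_ : (\int[leb]_t (J (z, t))%:E) = \int[leb]_(t in halfline) (osc a b z t)%:E)%E.
      apply: integrable_fin_num; first exact: measurable_halfline.
      apply: integrable_osc => //; apply: disc_Cplus; exact: set_mem.
    rewrite [RHS]integral_mkcond; apply: eq_integral => t _.
    by rewrite J_restrict restrict_EFin.
  by apply: eq_integral => t _; rewrite /f/= indicE zD mul1r.
have hR : (\int[leb]_t \int[leb2]_z f (z, t) = (osclap a b w * fine (area R (disc w r)))%:E)%E.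
  transitivity (\int[leb]_(t in halfline) (osc a b w t * fine (area R (disc w r)))%:E)%E.
    rewrite [RHS]integral_mkcond; apply: eq_integral => t _.
    rewrite patchE; case: ifPn => [/set_mem tH|tnH]; last first.
      apply: integral0_eq => z _; rewrite /f/= J_restrict patchE (negbTE tnH).
      by rewrite mulr0.
    rewrite -osc_disc// [RHS]integral_mkcond; apply: eq_integral => z _.
    rewrite /f/= J_restrict patchE mem_set// patchE indicE.
    by case: ifPn; rewrite ?mul1r ?mul0r.
  have io := integrable_osc Aa Ab wC.
  under eq_integral do rewrite EFinM.
  rewrite integralZr//; last exact: measurable_halfline.
  rewrite EFinM; congr (_ * _)%E; rewrite /osclap /Rintegral fineK//.
  by apply: integrable_fin_num => //; exact: measurable_halfline.
by rewrite /Rintegral; exact: (congr1 fine (etrans (esym hL) (etrans FE hR))).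
Qed.

End osclap_mean.

Section sub_mean.
Context {R : realType}.
Notation leb := (@lebesgue_measure R).

(** Integrate [2 v V <= v ^+ 2 + V ^+ 2] over the disc, with [v] the value at
    the centre, and use that the mean of [V] is [v]. The disc contains a
    square of area [r ^+ 2]. *)
Lemma osclap_sqr_sub_mean (a b : R -> R) (w : plane R) (r : R) :
  admissible a -> admissible b -> 0 < r -> r < w.1 ->
  ((osclap a b w ^+ 2 * r ^+ 2)%:E <=
   \int[area R]_(z in disc w r) (osclap a b z ^+ 2)%:E)%E.
Proof.
move=> Aa Ab r0 rw; set v := osclap a b w; pose V : plane R -> R := osclap a b.
have mD := measurable_disc w r.
have mV : measurable_fun setT V by exact: measurable_osclap.
have xr0 : 0 < w.1 - r by rewrite subr_gt0.
pose M := \int[leb]_(t in halfline) expabs a b (w.1 - r) t.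
have VM z : disc w r z -> `|V z| <= M.
  move=> Dz; have zC := disc_Cplus r0 rw Dz.
  rewrite (le_trans (norm_osclap_le Aa Ab zC))//; apply: le_Rintegral.
  - exact: measurable_halfline.
  - exact: integrable_expabs.
  - exact: integrable_expabs.
  - move=> t /halfline_gt0 t0; rewrite /expabs ler_wpM2r ?addr_ge0// ler_expR lerN2.
    rewrite ler_wpM2l ?(ltW t0)//.
    by have [] := disc_coord r0 Dz; rewrite ler_norml => /andP[? _] _; lra.
have iV : (area R).-integrable (disc w r) (EFin \o V) by exact: (integrable_disc r0 mV VM).
have iV2 : (area R).-integrable (disc w r) (EFin \o (fun z => V z ^+ 2)).
  apply: (@integrable_disc _ _ _ _ (M ^+ 2)) => //; first exact: measurable_funX.
  by move=> z Dz; rewrite normrX lerXn2r ?nnegrE ?VM// (le_trans _ (VM _ Dz)).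
have ic (c : R) : (area R).-integrable (disc w r) (EFin \o (fun _ => c)).
  by apply: (@integrable_disc _ _ _ _ `|c|).
set A := fine (area R (disc w r)).
have rA : r ^+ 2 <= A.
  rewrite -lee_fin /A fineK ?area_disc_ge// ge0_fin_numE//; exact: area_disc_lty.
have iVv : (area R).-integrable (disc w r) (EFin \o (fun z => 2 * v * V z)).
  exact: (integrableZl mD (2 * v) iV).
have : \int[area R]_(z in disc w r) (2 * v * V z) <=
    \int[area R]_(z in disc w r) (v ^+ 2 + V z ^+ 2).
  apply: le_Rintegral => //; first exact: (integrableD mD (ic _) iV2).
  by move=> z _; have := sqr_ge0 (v - V z); rewrite sqrrB -mulr_natl; lra.
rewrite RintegralZl// RintegralD// Rintegral_cst// osclap_disc_mean// -/A -/v => H.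
rewrite -[leRHS]fineK; last exact: integrable_fin_num.
rewrite lee_fin -[leRHS]/(\int[area R]_(z in disc w r) (V z ^+ 2)).
have : v ^+ 2 * r ^+ 2 <= v ^+ 2 * A by rewrite ler_wpM2l ?sqr_ge0.
by lra.
Qed.

End sub_mean.

(** * Laplace transforms and their complex derivative *)

Section laplace.
Context {R : realType}.
Notation leb := (@lebesgue_measure R).
Implicit Types (f : R -> R[i]) (z : plane R).

Definition fre f (t : R) : R := complex.Re (f t).
Definition fim f (t : R) : R := complex.Im (f t).

Lemma laplaceE f z : laplace f (toC z) =
  Complex (osclap (fre f) (fim f) z) (osclap (fim f) (fun t => - fre f t) z).
Proof.
rewrite /laplace /osclap /toC /fre /fim; congr Complex; apply: eq_Rintegral => t _.
all: rewrite /osc /cexp; case: (f t) => x y /=; rewrite !mul0r subr0 addr0 cosN sinN; ring.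
Qed.

Lemma normc_le (x y : R) : ComplexField.Normc.normc (Complex x y) <= `|x| + `|y|.
Proof.
rewrite /ComplexField.Normc.normc/= -[leRHS]ger0_norm ?addr_ge0// -sqrtr_sqr.
rewrite ler_wsqrtr// sqrrD !real_normK ?num_real//.
rewrite -addrA lerD2l addrC lerDl mulrn_wge0// mulr_ge0//.
Qed.

Lemma norm_re_le (x y : R) : `|x| <= ComplexField.Normc.normc (Complex x y).
Proof. by rewrite /ComplexField.Normc.normc/= -sqrtr_sqr ler_wsqrtr// lerDl sqr_ge0. Qed.

Lemma norm_im_le (x y : R) : `|y| <= ComplexField.Normc.normc (Complex x y).
Proof. by rewrite /ComplexField.Normc.normc/= -sqrtr_sqr ler_wsqrtr// lerDr sqr_ge0. Qed.

Lemma normcE (z : R[i]) : `|z| = (ComplexField.Normc.normc z)%:C%C.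
Proof. by case: z. Qed.

Lemma cderivP (F : R[i] -> R[i]) (x p : R[i]) (M eta : R) : 0 < eta -> 0 < M ->
  (forall h k : R, `|h| <= eta -> `|k| <= eta ->
    let F' := F (x + Complex h k) - F x - Complex h k * p in
    `|complex.Re F'| <= M * (h ^+ 2 + k ^+ 2) /\ `|complex.Im F'| <= M * (h ^+ 2 + k ^+ 2)) ->
  cderiv F x = p.
Proof.
move=> eta0 M0 H; rewrite /cderiv /derive1.
apply: (@cvg_lim (R[i]^o)); first exact: norm_hausdorff.
apply/cvgrPdist_le => -[e e'] /=; rewrite ltcE/= => /andP[/eqP e'0 e0]; subst e'.
(* Within distance [d] the difference quotient differs from [p] by at most
   [2 * M * d]. *)
pose d := Num.min eta (e / (2 * M)).
have d0 : 0 < d by rewrite lt_min eta0 divr_gt0// mulr_gt0.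
have dC0 : 0 < d%:C%C by rewrite ltcR.
suff key (h : R[i]) : h != 0 -> `|h| < d%:C%C ->
    `|p - h^-1 *: ((F (h + x) - F x) : R[i]^o)| <= (e%:C)%C.
  near=> h; apply: key; near: h.
    exact: (@nbhs_dnbhs_neq (R[i]^o) 0).
  exact: (@dnbhs0_lt _ (R[i]^o)).
case: h => h k h0.
rewrite normcE ltcR => hd.
have h_eta : `|h| <= eta.
  by rewrite (le_trans (norm_re_le h k))// (le_trans (ltW hd))// ge_min lexx.
have k_eta : `|k| <= eta.
  by rewrite (le_trans (norm_im_le h k))// (le_trans (ltW hd))// ge_min lexx.
have [HR HI] := H _ _ h_eta k_eta.
set D := F (x + Complex h k) - F x - Complex h k * p in HR HI.
have -> : p - (Complex h k)^-1 *: (F (Complex h k + x) - F x) = - ((Complex h k)^-1 * D).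
  rewrite /D mulrBr mulrA mulVf// mul1r opprB [Complex h k + x]addrC.
  by rewrite /GRing.scale/=.
rewrite normrN normcE lecR ComplexField.Normc.normcM ComplexField.Normc.normcV.
set N := ComplexField.Normc.normc (Complex h k).
have N2 : N ^+ 2 = h ^+ 2 + k ^+ 2 by rewrite /N /= sqr_sqrtr ?addr_ge0 ?sqr_ge0.
have N0 : 0 < N.
  rewrite lt_def sqrtr_ge0 andbT; apply: contra h0 => /eqP n0; apply/eqP.
  by apply: ComplexField.Normc.eq0_normc.
have DN : ComplexField.Normc.normc D <= 2 * M * N ^+ 2.
  case: D HR HI => u v /= HR HI; rewrite (le_trans (normc_le u v))// N2.
  by lra.
rewrite ler_pdivrMl// (le_trans DN)// expr2 mulrA [leRHS]mulrC ler_wpM2r ?(ltW N0)//.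
have : N <= e / (2 * M) by rewrite (le_trans (ltW hd))// ge_min lexx orbT.
by rewrite ler_pdivlMr ?mulr_gt0// mulrC.
Unshelve. all: by end_near. Qed.

End laplace.

(** * Data with finite weighted norm *)

Section membership.
Context {R : realType}.
Notation leb := (@lebesgue_measure R).

Lemma integrable_expRN (x : R) : 0 < x ->
  leb.-integrable halfline (fun t : R => (expR (- (t * x)))%:E).
Proof.
move=> x0; have mH := @measurable_halfline R.
have := integrableZl mH x^-1
  (integrableS measurableT mH (@subsetT _ _) (integrable_exponential_pdf x0)).
apply: eq_integrable => // t /set_mem/halfline_gt0 t0 /=.
rewrite -EFinM exponential_pdfE ?ltW//=; congr EFin.
by rewrite mulrA mulVf ?gt_eqF// mul1r mulNr mulrC.
Qed.

(** Keep the term [n = 0] of the weight, and in it only the mass of [0, e[. *)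
Lemma expR_mul_le_weight (m : option nat)
    (nu : nat -> {measure set (measurableTypeR R) -> \bar R}) (e : R) :
  (0 < nu 0%N `[0%R, e[%classic)%E ->
  exists2 c : R, 0 < c & forall t, 0 < t ->
    ((c * expR (- (2 * e * t)))%:E <= weight m nu t)%E.
Proof.
move=> nu0; have [c c0 cnu] : exists2 c : R, 0 < c & (c%:E <= nu 0%N `[0%R, e[%classic)%E.
  case: (nu 0%N `[0%R, e[%classic) nu0 => [r r0|_|//].
    by exists r.
  by exists 1 => //; rewrite leey.
exists (2 * pi * c) => [|t t0]; first by rewrite !mulr_gt0// pi_gt0.
have wn_ge0 n : (0 <= wn nu n t)%E.
  apply: mule_ge0.
    by rewrite lee_fin !mulr_ge0 ?pi_ge0// exprn_ge0// ltW.
  by apply: integral_ge0 => r _; rewrite lee_fin expR_ge0.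
apply: (@le_trans _ _ (wn nu 0%N t)); last first.
  rewrite /weight; apply: le_trans (@nneseries_lim_ge _ (wn nu ^~ t) (index_le ^~ m) 0%N 1%N _).
    by rewrite big_mkcond big_nat1 /index_le; case: m.
  by move=> n _ _; exact: wn_ge0.
rewrite /wn muln0 expr0 mulr1 -mulrA EFinM lee_wpmul2l ?lee_fin ?mulr_ge0 ?pi_ge0//.
have le1 : (\int[nu 0%N]_(r in `[0%R, +oo[%classic)
     ((expR (- (2 * e * t)))%:E * (\1_(`[0%R, e[) r)%:E) <=
   \int[nu 0%N]_(r in `[0%R, +oo[%classic) (expR (- (2 * r * t)))%:E)%E.
  apply: ge0_le_integral_any => r; rewrite /= in_itv/= andbT => r0.
    by rewrite -EFinM lee_fin mulr_ge0 ?expR_ge0.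
  rewrite -EFinM lee_fin indicE; case: (boolP (r \in _)) => [/set_mem|_].
    rewrite /= in_itv/= => /andP[_ re]; rewrite mulr1 ler_expR lerN2.
    by rewrite -!mulrA ler_wpM2l// ler_wpM2r ?ltW.
  by rewrite mulr0 expR_ge0.
apply: le_trans le1.
have mE : measurable (`[0%R, e[%classic : set (measurableTypeR R)) by exact: measurable_itv.
have mO : measurable (`[0%R, +oo[%classic : set (measurableTypeR R)) by exact: measurable_itv.
rewrite ge0_integralZl//; last first.
  by apply/measurable_EFinP; apply: measurable_funTS; exact: measurable_indic.
rewrite integral_indic// setIidl; last first.
  by move=> r; rewrite /= !in_itv/= andbT => /andP[].
by rewrite EFinM muleC lee_wpmul2l// lee_fin expR_ge0.
Qed.

(** With [e = x / 2] in [expR_mul_le_weight], [exp (- t x) |f| ^+ 2] is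
    integrable; then [|f| <= |f| ^+ 2 + 1]. *)
Lemma L2_admissible (m : option nat)
    (nu : nat -> {measure set (measurableTypeR R) -> \bar R})
    (f : R -> R[i]) :
  (forall e : R, 0 < e -> (0 < nu 0%N `[0%R, e[%classic)%E) ->
  L2 (weight m nu) f -> admissible (fre f) /\ admissible (fim f).
Proof.
move=> nu0 [mre mim L2f].
have mH := @measurable_halfline R.
have key (g : R -> R) : measurable_fun halfline g ->
    (forall t, g t ^+ 2 <= cmod (f t) ^+ 2) -> admissible g.
  move=> mg gf; split=> // x x0; have x20 : 0 < x / 2 by rewrite divr_gt0.
  have [c c0 cw] := expR_mul_le_weight m (nu0 _ x20).
  have mex : measurable_fun halfline (fun t : R => expR (- (t * x))) by exact: measurable_expRN.
  have mg2 : measurable_fun halfline (fun t => expR (- (t * x)) * g t ^+ 2).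
    by apply: measurable_funM => //; exact: measurable_funX.
  have ig2 : leb.-integrable halfline (fun t => (expR (- (t * x)) * g t ^+ 2)%:E).
    apply/integrableP; split; first exact/measurable_EFinP.
    have le_L2 : (\int[leb]_(t in halfline) (c%:E * (expR (- (t * x)) * g t ^+ 2)%:E) <=
        L2_sqnorm (weight m nu) f)%E.
      apply: ge0_le_integral_any => t /halfline_gt0 t0.
        by rewrite -EFinM lee_fin mulr_ge0 ?(ltW c0)// mulr_ge0 ?expR_ge0 ?sqr_ge0.
      have := cw t t0; rewrite (_ : 2 * (x / 2) * t = t * x); last by field.
      move=> cwt; rewrite -EFinM mulrA mulrC EFinM.
      apply: lee_pmul => //; rewrite ?lee_fin ?sqr_ge0// ?mulr_ge0 ?expR_ge0// ltW//.
    rewrite ge0_integralZl// in le_L2; last 3 first.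
    - exact/measurable_EFinP.
    - by move=> t _; rewrite lee_fin mulr_ge0 ?expR_ge0 ?sqr_ge0.
    - by rewrite lee_fin ltW.
    have abs_g2 (t : R) : `|(expR (- (t * x)) * g t ^+ 2)%:E|%E = (expR (- (t * x)) * g t ^+ 2)%:E.
      by rewrite gee0_abs// lee_fin mulr_ge0 ?expR_ge0 ?sqr_ge0.
    under eq_integral do rewrite abs_g2.
    rewrite -(@lte_pmul2l _ c%:E) ?lte_fin//.
    by rewrite (le_lt_trans le_L2)// gt0_muley ?lte_fin.
  have := integrableD mH ig2 (integrable_expRN x0).
  apply: le_integrable => //.
    by apply/measurable_EFinP; exact: measurable_funM.
  move=> t _; rewrite -EFinD !abse_EFin lee_fin normrM !(ger0_norm (expR_ge0 _)).
  rewrite [leRHS]ger0_norm; last first.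
    by rewrite addr_ge0 ?expR_ge0//; apply: mulr_ge0; rewrite ?expR_ge0 ?sqr_ge0.
  rewrite -[X in _ + X]mulr1 -mulrDr ler_wpM2l ?expR_ge0//.
  rewrite -[g t ^+ 2]real_normK ?num_real//.
  by have := sqr_ge0 (`|g t| - 1); have := normr_ge0 (g t); nra.
have cmod2 t : cmod (f t) ^+ 2 = fre f t ^+ 2 + fim f t ^+ 2.
  rewrite /fre /fim /cmod; case: (f t) => x y /=.
  by rewrite sqr_sqrtr ?addr_ge0 ?sqr_ge0.
have re_le s : fre f s ^+ 2 <= cmod (f s) ^+ 2 by rewrite cmod2 lerDl sqr_ge0.
have im_le s : fim f s ^+ 2 <= cmod (f s) ^+ 2 by rewrite cmod2 lerDr sqr_ge0.
by split; apply: key.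
Qed.

Lemma expabs_le (a b : R -> R) (x y t : R) : 0 < t -> x <= y ->
  expabs a b y t <= expabs a b x t.
Proof.
move=> t0 xy; rewrite /expabs ler_wpM2r ?addr_ge0// ler_expR lerN2.
by rewrite ler_wpM2l// ltW.
Qed.

(** Dominated convergence along the integers, then monotonicity in [x]. *)
Lemma expabs_decay (a b : R -> R) (eta : R) : admissible a -> admissible b -> 0 < eta ->
  exists2 X : R, 0 < X & forall x, X <= x ->
    \int[leb]_(t in halfline) expabs a b x t <= eta.
Proof.
move=> Aa Ab eta0; have mH := @measurable_halfline R.
have i1 := integrable_expabs Aa Ab ltr01.
pose E n t := (expabs a b n.+1%:R t)%:E.
have iE n := integrable_expabs Aa Ab (ltr0Sn R n).
have mE n : measurable_fun halfline (E n) by exact: measurable_int (iE n).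
have E_cvg t : halfline t -> E n t @[n --> \oo] --> 0%E.
  move=> /halfline_gt0 t0; apply: cvg_EFin; first exact: nearW.
  rewrite (_ : 0 = 0 * (`|a t| + `|b t|)); last by rewrite mul0r.
  apply: cvgMl.
  have u_oo : t * n.+1%:R @[n --> \oo] --> +oo.
    apply/cvgryPge => A; near=> n.
    rewrite mulrC -ler_pdivrMr//; apply: (@le_trans _ _ n%:R); last by rewrite ler_nat.
    by near: n; exact: nbhs_infty_ger.
  exact: (cvg_comp _ _ u_oo (@cvgr_expR R)).
have E_le t n : halfline t -> (`|E n t| <= (EFin \o expabs a b 1) t)%E.
  move=> /halfline_gt0 t0; rewrite lee_fin ger0_norm ?expabs_ge0//.
  by apply: expabs_le => //; rewrite ler1n.
have aeE : {ae leb, forall t : R, halfline t -> E n t @[n --> \oo] --> (cst 0%E : R -> \bar R) t}.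
  exact: aeW.
have aeE_le : {ae leb, forall t : R, forall n, halfline t -> (`|E n t| <= (EFin \o expabs a b 1) t)%E}.
  by apply: aeW => t n; exact: E_le.
have [_ _ H] := dominated_convergence mH mE (measurable_cst _) aeE i1 aeE_le.
rewrite integral0 in H.
have {}H : fine (\int[leb]_(t in halfline) E n t) @[n --> \oo] --> 0 by exact: fine_cvg H.
have /cvgrPdist_le/(_ _ eta0)[n _ /(_ n (leqnn n))] := H.
rewrite sub0r normrN ger0_norm; last first.
  by apply: fine_ge0; apply: integral_ge0 => t _; rewrite lee_fin expabs_ge0.
move=> n_le; exists n.+1%:R => // x nx; apply: le_trans n_le.
apply: le_Rintegral => //.
  by apply: integrable_expabs => //; rewrite (lt_le_trans _ nx).
by move=> t /halfline_gt0 t0; exact: expabs_le.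
Unshelve. all: by end_near. Qed.

End membership.

(** * Chains of cells towards infinity *)

Section chain.
Context {R : realType}.
Notation leb := (@lebesgue_measure R).

Lemma is_derive_quadratic (phi : R -> R) (x d M eta : R) : 0 < eta -> 0 < M ->
  (forall h, `|h| <= eta -> `|phi (x + h) - phi x - h * d| <= M * h ^+ 2) ->
  is_derive x 1 phi d.
Proof.
move=> eta0 M0 H.
have C : h^-1 *: (phi (h *: 1 + x) - phi x) @[h --> 0^'] --> d.
  apply/cvgrPdist_le => e e0.
  have m0 : 0 < Num.min eta (e / M) by rewrite lt_min eta0 divr_gt0.
  near=> h.
  have h0 : h != 0 by near: h; exact: nbhs_dnbhs_neq.
  have : `|h| < Num.min eta (e / M) by near: h; exact: dnbhs0_lt.
  rewrite lt_min => /andP[/ltW h_eta h_e].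
  rewrite /GRing.scale/= mulr1 [h + x]addrC.
  rewrite (_ : d - _ = - (h^-1 * (phi (x + h) - phi x - h * d))); last by field.
  rewrite normrN normrM normfV ler_pdivrMl ?normr_gt0// (le_trans (H _ h_eta))//.
  rewrite -[h ^+ 2]real_normK ?num_real// expr2 mulrA mulrC ler_wpM2l//.
  by rewrite mulrC -ler_pdivlMr// ltW.
apply: DeriveDef; first by apply/cvg_ex; exists d.
exact/cvg_lim.
Unshelve. all: by end_near. Qed.

Variables (a b : R -> R).
Hypotheses (Aa : admissible a) (Ab : admissible b).

Lemma is_derive_osclap (z : plane R) : Cplus z ->
  is_derive z.1 1 (fun x : R => osclap a b (x, z.2)) (osc_dx a b z).
Proof.
move=> z0; have [M M0 H] := osclap_taylor Aa Ab z0.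
apply: (@is_derive_quadratic _ _ _ M (z.1 / 2)) => //; first by rewrite divr_gt0.
move=> h hz; have := H h 0 hz.
by rewrite addr0 mul0r addr0 expr0n/= addr0 -surjective_pairing.
Qed.

Lemma osclap_step (y x1 x2 B : R) : 0 < x1 -> x1 <= x2 ->
  (forall x, x1 < x < x2 -> `|osc_dx a b (x, y)| <= B) ->
  `|osclap a b (x1, y)| <= `|osclap a b (x2, y)| + B * (x2 - x1).
Proof.
move=> x10; rewrite le_eqVlt => /predU1P[->|x12] H; first by rewrite subrr mulr0 addr0.
have D (x : R) : 0 < x -> is_derive x 1 (fun x : R => osclap a b (x, y)) (osc_dx a b (x, y)).
  by move=> x0; exact: (@is_derive_osclap (x, y)).
have cV : {within `[x1, x2], continuous (fun x : R => osclap a b (x, y))}.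
  apply: derivable_within_continuous => x; rewrite in_itv/= => /andP[x1x _].
  by have := D x (lt_le_trans x10 x1x) => ?; exact: ex_derive.
have DI (x : R) : x \in `]x1, x2[ ->
    is_derive x 1 (fun x : R => osclap a b (x, y)) (osc_dx a b (x, y)).
  by rewrite in_itv/= => /andP[x1x _]; apply: D; exact: lt_trans x1x.
have [x + E] := MVT x12 DI cV.
rewrite in_itv/= => /H HB.
rewrite -[X in `|X| <= _](subrK (osclap a b (x2, y))) (le_trans (ler_normD _ _))//.
rewrite addrC lerD2l distrC E normrM (gtr0_norm (_ : 0 < x2 - x1)) ?subr_gt0//.
by rewrite ler_wpM2r// subr_ge0 ltW.
Qed.

Definition cell (k : int) (y : R) : int * int := (k, Num.floor (y / side k)).

Lemma cell_itv (k : int) (y : R) : lo (cell k y) <= y < lo (cell k y) + side k.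
Proof.
have s0 := @side_gt0 R k; rewrite /lo/=.
have /andP[h1 h2] := floor_itv (y / side k).
rewrite -ler_pdivlMr// h1/=.
by move: h2; rewrite intrD ltr_pdivrMr// mulrDl mul1r.
Qed.

(** The [i]-th step moves right inside the upper half of the box at scale [k0
    + i], from its left side (from [z] for [i = 0]) to its right side. The
    vertical position does not change, so all these boxes contain [z]. *)
Lemma osclap_chain (G : int * int -> R) (z : plane R) (k0 : int) (n : nat) :
  (forall q w, dtop q w -> side q.1 * `|osc_dx a b w| <= G q) ->
  (forall q, 0 <= G q) ->
  side k0 / 2 <= z.1 < side k0 ->
  `|osclap a b z| <= \sum_(i < n.+1) G (cell (k0 + i%:Z) z.2)
    + `|osclap a b (side (k0 + n%:Z), z.2)|.
Proof.
move=> HG G0 /andP[z1 z2].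
have step k (x : R) : 0 < x -> side k / 2 <= x <= side k ->
    `|osclap a b (x, z.2)| <= `|osclap a b (side k, z.2)| + G (cell k z.2).
  move=> x0 /andP[kx xk]; have s0 := @side_gt0 R k.
  have := @osclap_step z.2 x (side k) (G (cell k z.2) / side k) x0 xk _.
  move=> /(_ _)/le_trans; apply.
    move=> u /andP[xu uk]; rewrite ler_pdivlMr// mulrC.
    apply: (HG (cell k z.2) (u, z.2)); split; last exact: cell_itv.
    by rewrite /= uk andbT; lra.
  rewrite lerD2l -mulrA ler_piMr// ler_pdivrMl// mulr1.
  lra.
elim: n => [|n IH].
  rewrite big_ord_recl big_ord0 !addr0 addrC {1}(surjective_pairing z).
  apply: step; last by rewrite z1 ltW.
  by have := @side_gt0 R k0; lra.
rewrite (le_trans IH)// [in leRHS]big_ord_recr/= -[leRHS]addrA lerD2l [leRHS]addrC.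
(* The right side of a box is the midpoint of the next one. *)
have sS : side (k0 + n%:Z) = side (k0 + n.+1%:Z) / 2 :> R.
  by rewrite -side_pred; congr side; lia.
apply: step; first exact: side_gt0.
have := @side_gt0 R (k0 + n.+1%:Z); rewrite sS lexx/=.
by lra.
Qed.

End chain.

Section families.
Context {R : realType}.

(** The cells with both indices at most [N] in absolute value, enumerated by a
    finite type: finite windows that exhaust all cells. *)
Definition window (N : nat) (i : 'I_(2 * N).+1 * 'I_(2 * N).+1) : int * int :=
  ((i.1 : nat)%:Z - N%:Z, (i.2 : nat)%:Z - N%:Z).

Lemma window_inj N : injective (@window N).
Proof.
move=> [i j] [i' j'] [] /= e1 e2.
by congr (_, _); apply: val_inj => /=; lia.
Qed.

Lemma window_surj N q : (`|q.1| <= N)%N -> (`|q.2| <= N)%N -> exists i, @window N i = q.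
Proof.
case: q => k j /= kN jN.
exists (inord `|k + N%:Z|, inord `|j + N%:Z|).
by rewrite /window /= !inordK; [congr (_, _)|..]; lia.
Qed.

Lemma sum_window_ge (N n : nat) (qq : nat -> int * int) (g : int * int -> R) :
  (forall q, 0 <= g q) -> injective qq ->
  (forall i, (i < n)%N -> (`|(qq i).1| <= N)%N /\ (`|(qq i).2| <= N)%N) ->
  \sum_(i < n) g (qq i) <= \sum_i g (@window N i).
Proof.
move=> g0 qq_inj qqN.
have /choice[e eE] : forall i : 'I_n, exists j, @window N j = qq i.
  by move=> i; have [h1 h2] := qqN i (ltn_ord i); exact: window_surj.
have e_inj : injective e.
  by move=> i j ij; apply: val_inj; apply: qq_inj; rewrite -!eE ij.
under eq_bigr do rewrite -eE.
rewrite -(big_imset (fun j => g (window j)))/=; last by move=> i j _ _; exact: e_inj.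
by rewrite [leLHS]big_mkcond; apply: ler_sum => j _; case: ifP.
Qed.

Lemma side_unbounded (X : R) (k0 : int) : exists n : nat, X <= side (k0 + n%:Z).
Proof.
have s0 := @side_gt0 R k0.
exists (Num.Def.archi_bound (X / side k0)).
set n := Num.Def.archi_bound _.
have -> : side (k0 + n%:Z) = 2 ^+ n * side k0 :> R.
  by rewrite /side expfzDr// mulrC.
rewrite -ler_pdivrMr//; have [X0|/ltW X0] := leP 0 (X / side k0).
  rewrite (le_trans (ltW (archi_boundP X0)))// -/n -natrX ler_nat ltnW//.
  exact: ltn_expl.
by rewrite (le_trans X0)// exprn_ge0.
Qed.

Lemma side_exists (x : R) : 0 < x -> exists k : int, side k / 2 <= x < side k.
Proof.
move=> x0.
have [n1 H1] := side_unbounded (x + 1) 0.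
have [n2 H2] := side_unbounded x^-1 0.
rewrite !add0r in H1 H2.
have sN : side (- n2%:Z) <= x.
  by rewrite /side -invr_expz -[leRHS]invrK lef_pV2 ?posrE ?invr_gt0// exprz_gt0.
(* Scales below [- n2] are excluded, so a least admissible scale exists. *)
pose P (n : nat) := x < side (n%:Z - n2%:Z).
have exP : exists n, P n.
  exists (n1 + n2)%N; rewrite /P PoszD addrK (lt_le_trans _ H1)//; lra.
case: (ex_minnP exP) => -[|n] Pn minn.
  by move: Pn; rewrite /P sub0r ltNge sN.
exists (n.+1%:Z - n2%:Z); rewrite -/(P n.+1) Pn andbT -side_pred.
rewrite (_ : _ - _ - 1 = n%:Z - n2%:Z); last by lia.
by rewrite leNgt; apply/negP => /minn; rewrite ltnn.
Qed.

End families.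

(** * The dyadic majorant of a transform *)

Section transform.
Context {R : realType}.
Notation leb := (@lebesgue_measure R).

Lemma osclapN (a b : R -> R) (z : plane R) : admissible a -> admissible b -> Cplus z ->
  osclap (fun t => - a t) (fun t => - b t) z = - osclap a b z.
Proof.
move=> Aa Ab zC; rewrite -mulN1r /osclap -RintegralZl//; last 2 first.
- exact: measurable_halfline.
- exact: integrable_osc.
by apply: eq_Rintegral => t _; rewrite /osc; ring.
Qed.

Variables (F : R[i] -> R[i]) (f : R -> R[i]).
Hypothesis Ff : is_laplace F f.
Let a := fre f.
Let b := fim f.
Let b' t := - fre f t.
Hypotheses (Aa : admissible a) (Ab : admissible b).

Let Ab' : admissible b'. Proof. exact: admissibleN. Qed.

Lemma transform_value z : Cplus z -> F (toC z) = Complex (osclap a b z) (osclap b b' z).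
Proof. by move=> zC; rewrite Ff// laplaceE. Qed.

(** The Cauchy-Riemann equations are visible on the data: the [y]-derivative
    for [(a, b)] is the opposite of the [x]-derivative for [(b, - a)], and the
    [y]-derivative for [(b, - a)] is the [x]-derivative for [(a, b)]. *)
Lemma transform_cderiv z : Cplus z ->
  cderiv F (toC z) = Complex (osc_dx a b z) (osc_dx b b' z).
Proof.
move=> zC.
have [M1 M10 H1] := osclap_taylor Aa Ab zC.
have [M2 M20 H2] := osclap_taylor Ab Ab' zC.
have z20 : 0 < z.1 / 2 by rewrite divr_gt0.
apply: (@cderivP _ _ _ _ (M1 + M2) (z.1 / 2)) => //; first by rewrite addr_gt0.
move=> h k hz kz /=.
have dy1 : osc_dy a b z = - osc_dx b b' z.
  rewrite /osc_dy /osc_dx -osclapN//; [|exact/admissibleN/admissible_id..].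
  by congr (osclap _ _ z); apply/funext => t; rewrite opprK// /b' mulrN.
have dy2 : osc_dy b b' z = osc_dx a b z.
  by rewrite /osc_dy /osc_dx; congr (osclap _ _ z); apply/funext => t; rewrite /b' mulrN.
have zhC : Cplus (z.1 + h, z.2 + k).
  by move: hz zC; rewrite ler_norml /Cplus/= => /andP[]; lra.
have -> : toC z + Complex h k = toC (z.1 + h, z.2 + k) by [].
rewrite !transform_value//= /toC.
have hk0 : 0 <= h ^+ 2 + k ^+ 2 by rewrite addr_ge0 ?sqr_ge0.
split.
  have := H1 h k hz; rewrite dy1 mulrN => /le_trans; apply.
  by rewrite ler_wpM2r// lerDl ltW.
have := H2 h k hz; rewrite dy2 => /le_trans; apply.
by rewrite ler_wpM2r// lerDr ltW.
Qed.

Lemma cmod_sqr (x y : R) : cmod (Complex x y : R[i]) ^+ 2 = x ^+ 2 + y ^+ 2.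
Proof. by rewrite /cmod/= sqr_sqrtr// addr_ge0 ?sqr_ge0. Qed.

Let P : plane R -> R := osc_dx a b.
Let Q : plane R -> R := osc_dx b b'.

Let admissible_dx (c : R -> R) : admissible c -> admissible (fun t => - (t * c t)).
Proof. by move=> Ac; exact/admissibleN/admissible_id. Qed.

Let mP : measurable_fun [set: plane R] P.
Proof. exact: (measurable_osclap (admissible_dx Aa) (admissible_dx Ab)). Qed.

Let mQ : measurable_fun [set: plane R] Q.
Proof. exact: (measurable_osclap (admissible_dx Ab) (admissible_dx Ab')). Qed.

Variables (rho : plane R -> R) (delta : R).
Hypothesis mrho : measurable_fun (@Cplus R) rho.
Hypothesis rho0 : forall z, Cplus z -> 0 < rho z.
Hypothesis delta0 : 0 < delta.
Hypothesis rhoP : forall q z, whitney q z -> rho (centre q) <= delta * rho z.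

Definition energy (z : plane R) : \bar R := (cmod (cderiv F (toC z)) ^+ 2 * rho z)%:E.

Lemma energy_ge0 z : Cplus z -> (0 <= energy z)%E.
Proof. by move=> zC; rewrite lee_fin mulr_ge0 ?sqr_ge0 ?ltW ?rho0. Qed.

Lemma energyE z : Cplus z -> energy z = ((P z ^+ 2 + Q z ^+ 2) * rho z)%:E.
Proof. by move=> zC; rewrite /energy transform_cderiv// cmod_sqr. Qed.

Lemma measurable_energy : measurable_fun (@Cplus R) energy.
Proof.
apply: (eq_measurable_fun (fun z => ((P z ^+ 2 + Q z ^+ 2) * rho z)%:E)).
  by move=> z /set_mem zC; rewrite energyE.
apply/measurable_EFinP; apply: measurable_funM => //.
by apply: measurable_funTS; apply: measurable_funD; exact: measurable_funX.
Qed.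

Hypothesis energy_fin : (\int[area R]_(z in @Cplus R) energy z < +oo)%E.

Definition whitney_energy q : R := fine (\int[area R]_(z in whitney q) energy z).

Lemma whitney_energyE q :
  (\int[area R]_(z in whitney q) energy z = (whitney_energy q)%:E)%E.
Proof.
rewrite /whitney_energy fineK// ge0_fin_numE; last first.
  by apply: integral_ge0 => z /whitney_Cplus; exact: energy_ge0.
apply: le_lt_trans energy_fin; apply: ge0_subset_integral.
- exact: measurable_whitney.
- exact: measurable_Cplus.
- exact: measurable_energy.
- exact: energy_ge0.
- exact: whitney_Cplus.
Qed.

Lemma whitney_energy_ge0 q : 0 <= whitney_energy q.
Proof.
apply: fine_ge0; apply: integral_ge0 => z /whitney_Cplus; exact: energy_ge0.
Qed.

Lemma disc_whitney q (w : plane R) : dtop q w -> disc w (side q.1 / 4) `<=` whitney q.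
Proof.
have s0 := @side_gt0 R q.1; have r0 : 0 < side q.1 / 4 :> R by rewrite divr_gt0.
move=> [/andP[w1 w2] /andP[v1 v2]] z /(disc_coord r0)[].
rewrite !ler_norml => /andP[? ?] /andP[? ?]; split; first by apply/andP; split; lra.
by rewrite /centre/= ler_norml; apply/andP; split; lra.
Qed.

(** The sub-mean value property on the disc of radius [side q.1 / 4], followed
    by the comparison of [rho] with its value at the centre. *)
Lemma dtop_energy q (w : plane R) : dtop q w ->
  rho (centre q) * ((P w ^+ 2 + Q w ^+ 2) * (side q.1 / 4) ^+ 2) <=
  delta * whitney_energy q.
Proof.
move=> qw; set r := side q.1 / 4.
have s0 := @side_gt0 R q.1; have r0 : 0 < r by rewrite divr_gt0.
have rw : r < w.1 by case: qw => /andP[? _] _; rewrite /r; lra.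
have rc := rho0 (@centre_Cplus R q).
have mW := @measurable_whitney R q.
have mPQ : measurable_fun setT (fun z : plane R => P z ^+ 2 + Q z ^+ 2).
  by apply: measurable_funD; exact: measurable_funX.
rewrite -lee_fin [leRHS]EFinM -whitney_energyE -ge0_integralZl//; last 3 first.
- apply: measurable_funS measurable_energy; last exact: whitney_Cplus.
  exact: measurable_Cplus.
- by move=> z /whitney_Cplus; exact: energy_ge0.
- by rewrite lee_fin ltW.
apply: (@le_trans _ _ (\int[area R]_(z in whitney q) ((rho (centre q))%:E * (P z ^+ 2 + Q z ^+ 2)%:E))%E); last first.
  apply: ge0_le_integral_any => z qz.
    by rewrite -EFinM lee_fin mulr_ge0 ?(ltW rc)// addr_ge0 ?sqr_ge0.
  rewrite energyE; last exact: whitney_Cplus qz.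
  rewrite -!EFinM lee_fin mulrCA mulrC ler_wpM2l ?addr_ge0 ?sqr_ge0//.
  exact: rhoP.
rewrite ge0_integralZl//; last 3 first.
- by apply/measurable_EFinP; exact: measurable_funTS.
- by move=> z _; rewrite lee_fin addr_ge0 ?sqr_ge0.
- by rewrite lee_fin ltW.
rewrite EFinM lee_wpmul2l ?lee_fin ?(ltW rc)//.
apply: (@le_trans _ _ (\int[area R]_(z in disc w r) (P z ^+ 2 + Q z ^+ 2)%:E)%E); last first.
  apply: ge0_subset_integral => //.
  - exact: measurable_disc.
  - by apply/measurable_EFinP; exact: measurable_funTS.
  - by move=> z _; rewrite lee_fin addr_ge0 ?sqr_ge0.
  - exact: disc_whitney.
under eq_integral do rewrite EFinD.
rewrite ge0_integralD//; last 5 first.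
- exact: measurable_disc.
- by move=> z _; rewrite lee_fin sqr_ge0.
- by apply/measurable_EFinP; apply: measurable_funTS; exact: measurable_funX.
- by move=> z _; rewrite lee_fin sqr_ge0.
- by apply/measurable_EFinP; apply: measurable_funTS; exact: measurable_funX.
rewrite mulrDl EFinD leeD//; apply: osclap_sqr_sub_mean => //; exact: admissible_dx.
Qed.

(** Normalized so that it dominates [side q.1] times each component of the
    derivative on [dtop q]. *)
Definition cell_bound q : R := Num.sqrt (16 * delta * whitney_energy q / rho (centre q)).

Lemma cell_bound_sqr q : rho (centre q) * cell_bound q ^+ 2 = 16 * delta * whitney_energy q.
Proof.
have rc := rho0 (@centre_Cplus R q).
rewrite sqr_sqrtr; first by field; rewrite gt_eqF.
by rewrite divr_ge0 ?(ltW rc)// !mulr_ge0 ?whitney_energy_ge0// ltW.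
Qed.

Let le_cell_bound q (x y : R) :
  rho (centre q) * ((x ^+ 2 + y ^+ 2) * (side q.1 / 4) ^+ 2) <= delta * whitney_energy q ->
  side q.1 * `|x| <= cell_bound q.
Proof.
move=> H; have rc := rho0 (@centre_Cplus R q); have s0 := @side_gt0 R q.1.
rewrite -[leLHS]ger0_norm ?mulr_ge0 ?(ltW s0)// -sqrtr_sqr ler_wsqrtr//.
rewrite ler_pdivlMr// exprMn real_normK ?num_real//.
have : 0 <= rho (centre q) * (y ^+ 2 * (side q.1 / 4) ^+ 2).
  by rewrite mulr_ge0 ?(ltW rc)// mulr_ge0 ?sqr_ge0.
have E : side q.1 ^+ 2 * x ^+ 2 * rho (centre q) =
  16 * (rho (centre q) * (x ^+ 2 * (side q.1 / 4) ^+ 2)) by field.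
by rewrite E; lra.
Qed.

Lemma cell_bound_dx q (w : plane R) : dtop q w -> side q.1 * `|P w| <= cell_bound q.
Proof. by move/dtop_energy; exact: le_cell_bound. Qed.

Lemma cell_bound_im q (w : plane R) : dtop q w -> side q.1 * `|Q w| <= cell_bound q.
Proof. by move/dtop_energy; rewrite [_ ^+ 2 + _]addrC; exact: le_cell_bound. Qed.

Definition majorant (N : nat) (z : plane R) : R := \sum_i cell_bound (@window N i) * \1_(dbox (@window N i)) z.

Lemma majorant_ge0 N z : 0 <= majorant N z.
Proof. by apply: sumr_ge0 => i _; rewrite mulr_ge0// sqrtr_ge0. Qed.

(** Chain both components of [F] up to a scale where the remaining values are
    below [eta / 2]; the finitely many cells used lie in every large window. *)
Lemma norm_le_majorant z (eta : R) : Cplus z -> 0 < eta ->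
  exists N0, forall N, (N0 <= N)%N -> cmod (F (toC z)) <= 2 * majorant N z + eta.
Proof.
move=> zC eta0.
have [k0 k0P] := side_exists zC.
have eta20 : 0 < eta / 2 by rewrite divr_gt0.
have [X1 X10 H1] := expabs_decay Aa Ab eta20.
have [X2 X20 H2] := expabs_decay Ab Ab' eta20.
have [n nX] := @side_unbounded R (X1 + X2) k0.
have s0 := @side_gt0 R (k0 + n%:Z).
pose qq (i : nat) := cell (k0 + i%:Z) z.2.
have qq_inj : injective qq by move=> i j [] /=; lia.
(* A crude common bound for the indices of the cells of the chain. *)
pose N0 := (\sum_(i < n.+1) (`|(qq i).1| + `|(qq i).2|))%N.
exists N0 => N N0N.
have qqN i : (i < n.+1)%N -> (`|(qq i).1| <= N)%N /\ (`|(qq i).2| <= N)%N.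
  move=> ni; have : (`|(qq i).1| + `|(qq i).2| <= N0)%N.
    by rewrite /N0 (bigD1 (Ordinal ni))//= leq_addr.
  by lia.
have sum_le : \sum_(i < n.+1) cell_bound (qq i) <= majorant N z.
  pose g q := cell_bound q * \1_(dbox q) z.
  have g0 q : 0 <= g q by rewrite mulr_ge0// sqrtr_ge0.
  have := @sum_window_ge R N n.+1 qq g g0 qq_inj qqN.
  apply: le_trans; apply: ler_sum => i _; rewrite /g indicE mem_set ?mulr1//.
  split; last exact: cell_itv.
  have /andP[_ z1] := k0P.
  have zC' : 0 < z.1 by [].
  rewrite zC' /= (lt_le_trans z1)// leNgt side_lt; lia.
have tailC : Cplus (side (k0 + n%:Z), z.2 : R) by [].
have tail1 : `|osclap a b (side (k0 + n%:Z), z.2)| <= eta / 2.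
  by rewrite (le_trans (norm_osclap_le Aa Ab tailC))// H1//= (le_trans _ nX)// lerDl ltW.
have tail2 : `|osclap b b' (side (k0 + n%:Z), z.2)| <= eta / 2.
  by rewrite (le_trans (norm_osclap_le Ab Ab' tailC))// H2//= (le_trans _ nX)// lerDr ltW.
have g0 q : 0 <= cell_bound q by exact: sqrtr_ge0.
have c1 := osclap_chain Aa Ab n cell_bound_dx g0 k0P.
have c2 := osclap_chain Ab Ab' n cell_bound_im g0 k0P.
rewrite transform_value// (le_trans (normc_le _ _))//.
have c1' : `|osclap a b z| <= majorant N z + eta / 2 by apply: (le_trans c1); exact: lerD.
have c2' : `|osclap b b' z| <= majorant N z + eta / 2 by apply: (le_trans c2); exact: lerD.
by lra.
Qed.

(** If [x <= 2 * p + eta] then [x ^+ 2 - 2 * x * eta <= (2 * p) ^+ 2], so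
    [eta] is taken as the error [e] divided by [2 * x + 1]. *)
Lemma sqr_le_limn_einf z : Cplus z ->
  ((cmod (F (toC z)) ^+ 2)%:E <= limn_einf (fun N => (4 * majorant N z ^+ 2)%:E))%E.
Proof.
move=> zC; set x := cmod (F (toC z)).
have x0 : 0 <= x by rewrite /x /cmod; case: (F _) => ? ?; exact: sqrtr_ge0.
apply/lee_addgt0Pr => e e0.
pose eta := e / (2 * x + 1).
have den : 0 < 2 * x + 1 by lra.
have eta0 : 0 < eta by rewrite divr_gt0.
have [N0 HN] := norm_le_majorant zC eta0.
rewrite -leeBlDr// -EFinB.
pose u N := (4 * majorant N z ^+ 2)%:E.
apply: (@le_trans _ _ (einfs u N0)); last first.
  rewrite limn_einf_lim (cvg_lim _ (@cvg_einfs_sup _ u))//.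
  by apply: ereal_sup_ubound; exists N0.
apply: le_ereal_inf_tmp => _ [N /= N0N <-]; rewrite lee_fin.
have := HN N N0N; rewrite -/x; have := majorant_ge0 N z; set p := majorant N z => p0 xp.
have e_eq : e = eta * (2 * x + 1) by rewrite /eta; field; rewrite gt_eqF.
have [xe|xe] := leP eta x.
  have : (x - eta) ^+ 2 <= (2 * p) ^+ 2 by rewrite lerXn2r ?nnegrE; lra.
  by rewrite e_eq; nra.
by rewrite e_eq; nra.
Qed.

End transform.

Lemma measurable_dbox (R : realType) (q : int * int) : measurable (dbox q : set (plane R)).
Proof.
rewrite (_ : dbox q = `]0, side q.1[ `*` `[lo q, lo q + side q.1[).
  by apply: measurableX; exact: measurable_itv.
by apply/seteqP; split => -[x y]; rewrite /dbox/= !in_itv.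
Qed.

Local Open Scope ereal_scope.

Theorem theorem4 (R : realType) (m : option nat)
    (nu : nat -> {measure set (measurableTypeR R) -> \bar R})
    (nu_carried : forall n, index_le n m ->
       carried_by (nu n) `[0%R, +oo[%classic)
    (nu_regular : forall n, index_le n m -> regular_borel (nu n))
    (nu_doubling : forall n, index_le n m -> doubling (nu n))
    (rho : plane R -> R) (rho_regular : regular_weight rho)
    (rho_dominated : forall F, A2 m nu F ->
       \int[@area R]_(z in @Cplus R) (cmod (cderiv F (toC z)) ^+ 2 * rho z)%:E
         <= A2_sqnorm m nu F)
    (mu : {measure set (plane R) -> \bar R})
    (mu_carried : carried_by mu (@Cplus R))
    (mu_finite : forall a, Cplus a -> mu (Qbox a) < +oo)
    (mu_testing : exists2 C : R, (0 < C)%R & forall a, Cplus a ->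
       \int[@area R]_(z in Qbox a)
         ((mu (Qbox a `&` Qbox z) / (z.1)%:E) ^+ 2 * ((rho z)^-1)%:E)
         <= C%:E * mu (Qbox a)) :
  carleson_measure mu (A2 m nu) (A2_sqnorm m nu).
Proof.
have [C C0 testing] := mu_testing.
have [mrho rho0 _] := rho_regular.
have [delta delta0 rhoW] := regular_weight_whitney rho_regular.
have rhoP q z : whitney q z -> (rho z <= delta * rho (centre q))%R by move/rhoW => [].
have rhoP' q z : whitney q z -> (rho (centre q) <= delta * rho z)%R by move/rhoW => [].
(* The packing constant of [testing_packing]. *)
pose A : R := (8 * delta * C)%R.
have A0 : (0 < A)%R by rewrite !mulr_gt0.
(* 4 from [sqr_le_limn_einf], [4 * A] from [tree_embedding], [16 * delta] from
   [cell_bound_sqr], 6 from the overlap. *)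
exists (4 * (4 * A) * (16 * delta) * 6)%R => [|F AF]; first by rewrite !mulr_gt0.
have energy_le := rho_dominated F AF.
have [f L2f Ff] := AF.
have nu0 e : (0 < e)%R -> 0 < nu 0%N `[0%R, e[%classic.
  have [H _] : doubling (nu 0%N) by apply: nu_doubling; rewrite /index_le; case: (m).
  exact: H.
have [Aa Ab] := L2_admissible nu0 L2f.
have energy_fin : \int[area R]_(z in @Cplus R) energy F rho z < +oo.
  apply: (le_lt_trans energy_le); case: (L2f) => _ _; apply: le_lt_trans.
  by apply: ereal_inf_lbound; exists f.
pose Phi (N : nat) (z : plane R) : \bar R := (4 * majorant F rho delta N z ^+ 2)%:E.
have mmaj N : measurable_fun [set: plane R] (majorant F rho delta N).
  apply: measurable_sum => i; apply: measurable_funM => //.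
  by apply: measurable_indic; exact: measurable_dbox.
have mPhi N : measurable_fun [set: plane R] (Phi N).
  by apply/measurable_EFinP; apply: measurable_funM => //; exact: measurable_funX.
have Phi0 N z : 0 <= Phi N z by rewrite lee_fin mulr_ge0// sqr_ge0.
have mC := @measurable_Cplus R.
have le_liminf : \int[mu]_(z in @Cplus R) (cmod (F (toC z)) ^+ 2)%:E <=
    \int[mu]_(z in @Cplus R) limn_einf (Phi ^~ z).
  apply: ge0_le_integral_any => z zC; first by rewrite lee_fin sqr_ge0.
  exact: (sqr_le_limn_einf Ff Aa Ab mrho rho0 delta0 rhoP' energy_fin zC).
apply: (le_trans le_liminf).
apply: (le_trans (fatou mu mC (fun N => measurable_funTS (mPhi N)) (fun N z _ => Phi0 N z))).
set B := (_ * A2_sqnorm m nu F).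
suff bound N : \int[mu]_(z in @Cplus R) Phi N z <= B.
  rewrite limn_einf_lim (cvg_lim _ (@cvg_einfs_sup _ _))//.
  apply: ge_ereal_sup => _ [N _ <-]; apply: le_trans (bound N).
  by apply: ereal_inf_lbound; exists N => /=.
apply: (@le_trans _ _ (\int[mu]_z Phi N z)).
  by apply: ge0_subset_integral => //; exact: mPhi.
rewrite /Phi; under eq_integral do rewrite EFinM.
rewrite ge0_integralZl//; last 2 first.
- by apply/measurable_EFinP; exact: measurable_funX.
- by move=> z _; rewrite lee_fin sqr_ge0.
have tree := @tree_embedding _ _ R mu _ (fun i j => dle R (@window N i) (@window N j))
  (fun i => dbox (@window N i)) (fun i => cell_bound F rho delta (@window N i))
  (fun i => rho (centre (@window N i))) (fun i => mass mu (@window N i)) A.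
have {}tree := tree (fun i j l => @dle_chain R _ _ _) (fun z i j => @dbox_chain R _ _ _)
  (fun i => @measurable_dbox R _) (fun i => sqrtr_ge0 _)
  (fun i => rho0 _ (@centre_Cplus R _)) A0.
apply: (@le_trans _ _ (4%:E * (4 * A * \sum_i rho (centre (@window N i)) * cell_bound F rho delta (@window N i) ^+ 2)%:E)).
  rewrite lee_wpmul2l//; apply: tree => i.
    rewrite -massE//; apply: le_measure; rewrite ?inE.
    - exact: measurable_dbox.
    - exact: measurable_Qbox.
    - exact: dbox_Qbox.
  exact: (testing_packing rho0 delta0 rhoP mu_finite testing i (@window_inj N)).
under eq_bigr do rewrite (cell_bound_sqr F rho0 delta0).
rewrite -mulr_sumr; set S := (\sum_i whitney_energy F rho (window i))%R.
rewrite -EFinM /B [in leRHS]EFinM -[leRHS]muleA.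
have -> : (4 * (4 * A * (16 * delta * S)) = 4 * (4 * A) * (16 * delta) * S)%R by ring.
rewrite EFinM; apply: lee_wpmul2l.
  by rewrite lee_fin !mulr_ge0// ltW.
rewrite /S -sumEFin.
under eq_bigr do rewrite -(whitney_energyE Ff Aa Ab mrho rho0 energy_fin).
apply: le_trans (sum_integral_whitney (@window_inj N) (measurable_energy Ff Aa Ab mrho) (energy_ge0 F rho0)) _.
exact: lee_wpmul2l.
Qed.
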